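(* Let $k$ be a unital commutative ring, $n$ a positive integer, and let $\delta,\varepsilon\in k$ be invertible. Then there exist isomorphisms of graded $k$-modules \[\operatorname{Tor}_{\star}^{\mathcal{M}_n(\delta,\varepsilon)}(\mathbf{1},\mathbf{1})\cong\begin{cases}k&\star=0\\0&\star>0\end{cases}\quad\text{and}\quad\operatorname{Ext}^{\star}_{\mathcal{M}_n(\delta,\varepsilon)}(\mathbf{1},\mathbf{1})\cong\begin{cases}k&\star=0\\0&\star>0.\end{cases}\]
   Context: A rook-Brauer $n$-diagram is a graph on vertices $1,\dots,n$ (left column, top to bottom) and $\bar1,\dots,\bar n$ (right column), drawn in the rectangle they span, in which each edge joins two distinct vertices and each vertex lies on at most one edge; diagrams are determined by which pairs are joined. Edges joining the two columns are propagating. $\mathcal{RB}_n(\delta,\varepsilon)$ is the free $k$-module on these diagrams with product: identify the right column of $d_1$ with the left column of $d_2$ (middle column); let $\alpha$ be the number of closed loops lying in the middle column and $\beta$ the number of other connected components lying entirely in the middle column (isolated middle vertices, or paths with both ends in the middle column); let $d_3$ join two outer vertices iff they are joined by a path; $d_1d_2=\delta^\alpha\varepsilon^\beta d_3$. A Motzkin $n$-diagram is a planar rook-Brauer $n$-diagram (no two edges cross), and the Motzkin algebra $\mathcal{M}_n(\delta,\varepsilon)$ is the subalgebra of $\mathcal{RB}_n(\delta,\varepsilon)$ spanned by Motzkin $n$-diagrams. The augmentation $\tau$ sends diagrams with $n$ propagating edges to $1$ and all others to $0$; $\mathbf{1}$ is $k$ with the algebra acting via $\tau$. *)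

(* Defs.v *)
From HB Require Import structures.
From mathcomp Require Import all_boot all_order all_algebra.
Set Implicit Arguments. Unset Strict Implicit. Unset Printing Implicit Defensive.
Import GRing.Theory.
Local Open Scope ring_scope.

(* A vertex is (c, i) with c : 'I_2 the column (0 = left, 1 = right)    *)
(* and i : 'I_n the row (0 = top).  A rook-Brauer diagram is encoded as *)
(* an involution f of the vertex set: f x = y <> x means x, y are joined *)
(* by an edge, f x = x means x lies on no edge.                         *)

Definition vert (n : nat) := ('I_2 * 'I_n)%type.

Definition rb_diagram n (f : {ffun vert n -> vert n}) : bool :=
  [forall x, f (f x) == x].

(* position of a vertex going around the boundary of the rectangle:
   left column top to bottom, then right column bottom to top *)
Definition bpos n (x : vert n) : nat :=
  if (x.1 : nat) == 0%N then (x.2 : nat) else ((2 * n).-1 - x.2)%N.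

Definition chords_cross (p q r s : nat) : bool :=
  let a := minn p q in let b := maxn p q in
  let c := minn r s in let d := maxn r s in
  [&& (a < c)%N, (c < b)%N & (b < d)%N].

Definition planar n (f : {ffun vert n -> vert n}) : bool :=
  [forall x, forall y, ((f x != x) && (f y != y)) ==>
     ~~ chords_cross (bpos x) (bpos (f x)) (bpos y) (bpos (f y))].

Definition motzkin n (f : {ffun vert n -> vert n}) : bool :=
  rb_diagram f && planar f.

Definition MD (n : nat) := {f : {ffun vert n -> vert n} | motzkin f}.
HB.instance Definition _ n :=
  [isSub for (@proj1_sig _ (fun f : {ffun vert n -> vert n} => motzkin f) : MD n -> _)].
HB.instance Definition _ n := [Finite of MD n by <:].

(* Concatenation d1 d2: three columns 0 (left of d1), 1 (middle),      *)
(* 2 (right of d2).                                                     *)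
Section Compose.
Variable n : nat.
Implicit Types f g : {ffun vert n -> vert n}.

Definition wvert := ('I_3 * 'I_n)%type.

Definition emb1 (x : vert n) : wvert := (inord x.1, x.2).
Definition emb2 (x : vert n) : wvert := (inord x.1.+1, x.2).
Definition outer (x : vert n) : wvert := (inord (2 * x.1), x.2).

Definition edge1 f (y z : wvert) : bool :=
  [exists u : vert n, [&& emb1 u == y, emb1 (f u) == z & f u != u]].
Definition edge2 g (y z : wvert) : bool :=
  [exists u : vert n, [&& emb2 u == y, emb2 (g u) == z & g u != u]].

Definition crel f g : rel wvert := fun y z => edge1 f y z || edge2 g y z.

Definition middle (y : wvert) : bool := (y.1 : nat) == 1%N.

Definition middle_comp f g (y : wvert) : bool :=
  [forall z, connect (crel f g) y z ==> middle z].

Definition loop_comp f g (y : wvert) : bool :=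
  middle_comp f g y &&
  [forall z, connect (crel f g) y z ==>
     ([exists w, edge1 f z w] && [exists w, edge2 g z w])].

Definition comp_alpha f g : nat :=
  #|[set y | (fingraph.root (crel f g) y == y) && loop_comp f g y]|.
Definition comp_beta f g : nat :=
  #|[set y | [&& fingraph.root (crel f g) y == y, middle_comp f g y & ~~ loop_comp f g y]]|.

Definition compose f g : {ffun vert n -> vert n} :=
  [ffun v => odflt v [pick u | (u != v) && connect (crel f g) (outer v) (outer u)]].

End Compose.

(* Structure constants, augmentation, and the bar (co)complex           *)
(* computing Tor and Ext of the trivial module 1 (the algebra is free   *)
(* over k with basis MD n, so A^{(x) p} has basis p-tuples of diagrams).*)
Section Bar.
Variables (k : comPzRingType) (delta eps : k) (n : nat).

Definition mulc (a b d : MD n) : k :=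
  if val d == compose (val a) (val b)
  then delta ^+ comp_alpha (val a) (val b) * eps ^+ comp_beta (val a) (val b)
  else 0.

Definition nprop (f : {ffun vert n -> vert n}) : nat :=
  #|[set i : 'I_n | ((f (ord0, i)).1 : nat) == 1%N]|.

Definition tau (a : MD n) : k := if nprop (val a) == n then 1 else 0.

(* terms of the bar differential of [a_1|...|a_p] :
   tau(a_1)[a_2|...|a_p] + sum_{i=1}^{p-1} (-1)^i [..|a_i a_{i+1}|..]
   + (-1)^p tau(a_p) [a_1|...|a_{p-1}] *)
Definition bar_first (b : seq (MD n)) : seq (k * seq (MD n)) :=
  if b is a :: rest then [:: (tau a, rest)] else [::].

Definition bar_merge (b : seq (MD n)) (i : nat) : seq (k * seq (MD n)) :=
  match drop i b with
  | a :: a' :: rest =>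
      [seq ((-1) ^+ i.+1 * mulc a a' d, take i b ++ d :: rest) | d <- enum {: MD n}]
  | _ => [::]
  end.

Definition bar_last (b : seq (MD n)) : seq (k * seq (MD n)) :=
  if rev b is a :: _ then [:: ((-1) ^+ size b * tau a, take (size b).-1 b)]
  else [::].

Definition bar_terms (b : seq (MD n)) : seq (k * seq (MD n)) :=
  bar_first b ++ flatten [seq bar_merge b i | i <- iota 0 (size b)] ++ bar_last b.

Definition bar_coef (b b' : seq (MD n)) : k :=
  \sum_(t <- bar_terms b | t.2 == b') t.1.

(* p-chains  1 (x)_A B_p (x)_A 1 = A^{(x)p} and p-cochains Hom_k(A^{(x)p}, k) *)
Local Notation chain p := {ffun p.-tuple (MD n) -> k}.

Definition bar_d p (x : chain p.+1) : chain p :=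
  [ffun b' : p.-tuple (MD n) =>
     \sum_(b : p.+1.-tuple (MD n)) x b * bar_coef (val b) (val b')].

Definition bar_dual p (f : chain p) : chain p.+1 :=
  [ffun b : p.+1.-tuple (MD n) =>
     \sum_(b' : p.-tuple (MD n)) bar_coef (val b) (val b') * f b'].

End Bar.

Notation chain k n p := {ffun p.-tuple (MD n) -> k}.

(* Main.v *)
Require Import Defs.
From HB Require Import structures.
From mathcomp Require Import all_boot all_order perm all_algebra ring zify.
Import GRing.Theory.
Set Implicit Arguments.
Unset Strict Implicit.
Unset Printing Implicit Defensive.

(** The span I of the diagrams other than the identity is the augmentation ideal.
    By planarity each such diagram has, on its right side, an isolated row i or an arc
    joining rows i and i + 1; for a fixed choice of these data the diagrams showing it span
    a left ideal, and any intersection of such ideals is zero or generated by an element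
    e with x e proportional to x by an invertible scalar (a product of powers of delta and
    eps).  A left ideal of that kind has a contractible bar complex, and a Mayer-Vietoris
    argument propagates contracting homotopies to finite unions, hence to I.  Adding the
    words ending in 1 gives a contraction of the full bar complex in positive degrees, which
    yields both vanishing statements.

    The composition of diagrams is studied through pairs of involutions: the half-edges of
    the diagrams carry the involution F of the edges and the involution G gluing the
    columns, and components are the orbits of the group generated by F and G. *)

(** * Orbits of two involutions *)

(** The statement supplies only structure constants. That Motzkin diagrams are closed under
    [compose], so that no product is lost, and that the twisted product is associative, so that the
    differential squares to zero, has to be proved. Triple products are compared by gluing the two
    middle columns in either order; diagrams therefore become involutions that can be contracted in
    stages.

    The nonempty words whose last letter lies in a left ideal J without the identity are stable
    under the bar differential: merging keeps the last letter in J, and [tau] kills the last face.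
    If x e = c x for all x in J, with c invertible and independent of x, then appending e and
    dividing by c contracts this complex: the face merging e into the last letter restores the word,
    and the other terms cancel. This is where invertibility of delta and eps enters.

    Homotopies act on functions of words, not on chains. They are linear and read only words one
    letter longer, hence are matrices: applied directly they give Ext, transposed they give Tor. *)

Section Dihedral.
Variables (S : finType) (F G : S -> S).

Definition dih : rel S := fun x y => (y == F x) || (y == G x).

Definition hasfix (H : S -> S) (x : S) : bool :=
  [exists y, connect dih x y && (H y == y)].

(** An orbit is a path or a cycle alternating F and G, and a point fixed by G is an end of such a
    path. It goes to the other end if that is again fixed by G; a path ending in a fixed point of F
    makes it isolated, hence the default x. Points moved by G are consumed by the gluing and stay as
    fixed points. *)
Definition contr (x : S) : S :=
  if G x == x then
    odflt x [pick y | [&& y != x, G y == y & connect dih x y]]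
  else x.

(** Without a fixed point of G a component avoids the outer columns: it is a path between isolated
    vertices (b = true, weight eps) or a loop (b = false, weight delta). *)
Definition inner_orbit (b : bool) : pred S :=
  [pred x | (hasfix F x == b) && ~~ hasfix G x].

Definition inner_count (b : bool) : nat := n_comp dih (inner_orbit b).

Lemma dihF x : connect dih x (F x).
Proof. by apply: connect1; rewrite /dih eqxx. Qed.

Lemma dihG x : connect dih x (G x).
Proof. by apply: connect1; rewrite /dih eqxx orbT. Qed.

Lemma dih_ind (A : S -> Prop) x :
  (forall y, A y -> A (F y)) -> (forall y, A y -> A (G y)) ->
  A x -> forall y, connect dih x y -> A y.
Proof.
move=> AF AG Ax y /connectP [p]; elim: p x Ax => [|z p IH] x Ax /=; first by move=> _ ->.
by case/andP=> /orP [] /eqP -> ; apply: IH; [apply: AF | apply: AG].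
Qed.

Hypotheses (FK : involutive F) (GK : involutive G).

Lemma dih_sym : connect_sym dih.
Proof.
have sw (H : S -> S) x y : involutive H -> (y == H x) = (x == H y).
  by move=> HK; apply/eqP/eqP => ->; rewrite HK.
by apply: sym_connect_sym => x y; rewrite /dih (sw F) // (sw G).
Qed.

Lemma hasfix_closed H x y : connect dih x y -> hasfix H x = hasfix H y.
Proof.
move=> xy; apply: eq_existsb => z; congr (_ && _).
exact: (same_connect dih_sym).
Qed.

Lemma inner_orbit_closed b : closed dih (inner_orbit b).
Proof. by move=> x y /connect1 xy; rewrite !inE !(hasfix_closed _ xy). Qed.

Let P x := G (F x).

Let Pinj : injective P.
Proof. by apply: inj_comp; apply: can_inj; [exact: GK | exact: FK]. Qed.

Let iterP_inj i : injective (iter i P).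
Proof. by elim: i => // i IH x y /= /Pinj /IH. Qed.

Let iterPG x i : iter i P (G (iter i P x)) = G x.
Proof.
elim: i x => //= i IH x.
by rewrite -iterS iterSr [P (G _)]/P /P GK FK IH.
Qed.

(* Conjugation by G inverts P = G o F, so the orbit of a fixed point of G under
   both involutions is already its orbit under P. *)
Let orbP x y : G x = x -> connect dih x y ->
  exists2 i, i < order P x & y = iter i P x.
Proof.
move=> Gx xy; suff: fconnect P x y.
  by move=> h; exists (findex P x y); [exact: findex_max | rewrite iter_findex].
have cG z : fconnect P x z -> fconnect P x (G z).
  move=> h; rewrite fconnect_sym //.
  rewrite -[X in fconnect _ _ X]Gx -(iterPG x (findex P x z)) (iter_findex h); exact: fconnect_iter.
apply: (dih_ind (A := fun y => fconnect P x y)) xy => // z h.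
rewrite -[F z]GK; apply: cG; exact: (connect_trans h (fconnect1 _ _)).
Qed.

Let iterP0 x i : (i < order P x) -> iter i P x = x -> i = 0.
Proof. by move=> h e; move: (findex_iter h); rewrite e findex0. Qed.

Let iterP2 x i : G x = x -> G (iter i P x) = iter i P x <-> iter (i + i) P x = x.
Proof.
move=> Gx; rewrite iterD; split => e; first by rewrite -{1}e iterPG.
by have := iterPG x i; rewrite Gx -{2}e => /iterP_inj.
Qed.

Let iterP1 x i : G x = x -> F (iter i P x) = iter i P x <-> iter (i + i).+1 P x = x.
Proof.
move=> Gx; have -> : iter (i + i).+1 P x = iter i P (G (F (iter i P x))).
  by rewrite -addnS iterD.
split => e; first by rewrite e iterPG.
have := iterPG x i; rewrite Gx -{2}e => /iterP_inj.
by move/(congr1 G); rewrite !GK.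
Qed.

Let iterP_mod x i : i <= (order P x).*2 -> 0 < i -> iter i P x = x ->
  i = order P x \/ i = (order P x).*2.
Proof.
move=> le i0 e; case: (ltngtP i (order P x)) => h; [|right|by left].
  by move: i0; rewrite (iterP0 h e).
move: le; rewrite leq_eqVlt => /orP [/eqP //|lt].
have e2 : iter (i - order P x) P x = x.
  by move: e; rewrite -{1}(subnK (ltnW h)) iterD iter_order.
suff : i - order P x = 0 by lia.
apply: iterP0 e2; lia.
Qed.

(** With m the order of P at x, a second fixed point P^i x of G forces 2i = m, so it sits exactly
    halfway. *)
Lemma end_uniq x y z : G x = x -> G y = y -> G z = z ->
  connect dih x y -> connect dih x z -> y <> x -> z <> x -> y = z.
Proof.
move=> Gx Gy Gz /(orbP Gx) [i ilt ey] /(orbP Gx) [j jlt ez] nx ny; subst y z.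
move: Gy Gz; rewrite !(iterP2 _ Gx) => ei ej.
have i0 : 0 < i by case: (i) nx.
have j0 : 0 < j by case: (j) ny.
by congr (iter _ P x); case: (iterP_mod _ _ ei); case: (iterP_mod _ _ ej); lia.
Qed.

(** A second fixed point of G needs m even, a fixed point P^j x of F needs 2j + 1 = m odd. *)
Lemma end_excl x y z : G x = x -> G y = y -> connect dih x y -> y <> x ->
  connect dih x z -> F z <> z.
Proof.
move=> Gx Gy /(orbP Gx) [i ilt ey] nx /(orbP Gx) [j jlt ->{z}].
rewrite (iterP1 _ Gx) => ej; move: Gy; rewrite ey (iterP2 _ Gx) => ei.
have i0 : 0 < i by case: (i) ey nx.
by case: (iterP_mod _ _ ei); case: (iterP_mod _ _ ej); lia.
Qed.

Lemma end_exists x : G x = x ->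
  (exists y, [/\ y <> x, connect dih x y & G y = y]) \/ hasfix F x.
Proof.
move=> Gx; have cP i : connect dih x (iter i P x).
  elim: i => //= i h; apply: connect_trans h _.
  exact: connect_trans (dihF _) (dihG _).
set m := order P x; have m0 : 0 < m := order_gt0 _ _.
have em : iter m P x = x by apply: iter_order.
case: (boolP (odd m)) => om; [right | left].
  apply/existsP; exists (iter m./2 P x); rewrite cP; apply/eqP/(iterP1 _ Gx).
  by rewrite addnn -[X in iter X](_ : m = _) //; lia.
exists (iter m./2 P x); split => //.
  by move/iterP0 => h; have := h ltac:(rewrite -/m; lia); lia.
by apply/(iterP2 _ Gx); rewrite addnn -[X in iter X](_ : m = _) //; lia.
Qed.

Lemma contr_connect x : connect dih x (contr x).
Proof. by rewrite /contr; case: ifP => // _; case: pickP => //= y /and3P []. Qed.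

Lemma contr_fixG x : G x = x -> G (contr x) = contr x.
Proof.
by move=> Gx; rewrite /contr Gx eqxx; case: pickP => //= y /and3P [_ /eqP].
Qed.

Lemma contr_dead x : G x <> x -> contr x = x.
Proof. by move=> /eqP/negPf; rewrite /contr => ->. Qed.

Lemma contr_uniq x y : G x = x -> G y = y -> connect dih x y -> y <> x -> contr x = y.
Proof.
move=> Gx Gy xy nxy; rewrite /contr Gx eqxx; case: pickP => /= [z|/(_ y)].
  by case/and3P => /eqP zx /eqP Gz xz; exact: (end_uniq Gx Gz Gy xz xy zx nxy).
by move/eqP/negPf: nxy => ->; rewrite Gy eqxx xy.
Qed.

Lemma contrK : involutive contr.
Proof.
move=> x; case: (eqVneq (G x) x) => [Gx|/eqP n]; last by rewrite !(contr_dead n).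
case: (eqVneq (contr x) x) => [e|/eqP n]; first by rewrite !e.
have h : connect dih (contr x) x by rewrite dih_sym contr_connect.
exact: (contr_uniq (contr_fixG Gx) Gx h (fun e => n (esym e))).
Qed.

Lemma contr_id x : G x = x -> (contr x == x) = hasfix F x.
Proof.
move=> Gx; apply/eqP/idP => [e|/existsP [z /andP [xz /eqP Fz]]].
  case: (end_exists Gx) => // [[y [n xy Gy]]].
  by case: (n); rewrite -(contr_uniq Gx Gy xy n).
case: (eqVneq (contr x) x) => // /eqP n.
by case: (end_excl Gx (contr_fixG Gx) (contr_connect x) n xz).
Qed.

Lemma contr_step x : G x = x -> G (F x) = F x -> contr x = F x.
Proof.
move=> Gx GFx; case: (eqVneq (F x) x) => [e|/eqP n].
  by rewrite e; apply/eqP; rewrite contr_id //; apply/existsP; exists x; rewrite e eqxx connect0.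
exact: contr_uniq (dihF x) n.
Qed.

End Dihedral.

(** * Gluing in two stages *)

Section Stages.
Variables (S : finType) (F G G1 G2 : S -> S).
Hypotheses (FK : involutive F) (GK : involutive G).
Hypotheses (G1K : involutive G1) (G2K : involutive G2).
Hypothesis disj : forall x, G1 x = x \/ G2 x = x.
Hypothesis Gl : forall x, G2 x = x -> G x = G1 x.
Hypothesis Gr : forall x, G1 x = x -> G x = G2 x.

Let F1 := contr F G1.
Let F1K : involutive F1. Proof. exact: contrK. Qed.

Let fixG x : (G x == x) = (G1 x == x) && (G2 x == x).
Proof.
case: (disj x) => e.
  by rewrite (Gr e) e eqxx.
by rewrite (Gl e) e eqxx andbT.
Qed.

Let G21 x : G1 x = x -> G1 (G2 x) = G2 x.
Proof.
by move=> e; case: (disj (G2 x)) => // h; move: (congr1 G2 h); rewrite !G2K => ->.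
Qed.

Let dcG1 x y : connect (dih F G1) x y -> connect (dih F G) x y.
Proof.
move=> xy; apply: (dih_ind (A := fun y => connect (dih F G) x y)) xy => [z h|z h|].
- exact: connect_trans h (dihF _ _ _).
- case: (disj z) => e; first by rewrite e.
  by rewrite -(Gl e); exact: connect_trans h (dihG _ _ _).
- exact: connect0.
Qed.

Let dcF1 x y : connect (dih F1 G2) x y -> connect (dih F G) x y.
Proof.
move=> xy; apply: (dih_ind (A := fun y => connect (dih F G) x y)) xy => [z h|z h|].
- exact/(connect_trans h)/dcG1/contr_connect.
- case: (disj z) => e; last by rewrite e.
  by rewrite -(Gr e); exact: connect_trans h (dihG _ _ _).
- exact: connect0.
Qed.

(* Every slot of the orbit of x under F and G is reached by a slot alive after
   the first contraction, so a path between live slots can be shortcut. *)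
Let reach x z : G1 x = x -> connect (dih F G) x z ->
  exists2 y, G1 y = y /\ connect (dih F1 G2) x y & connect (dih F G1) y z.
Proof.
move=> G1x xz; apply: (dih_ind (A := fun z => exists2 y, G1 y = y /\ connect (dih F1 G2) x y
  & connect (dih F G1) y z)) xz => [{}z [y h1 h2]|{}z [y [Gy h1] h2]|].
- by exists y => //; apply: connect_trans h2 (dihF _ _ _).
- case: (disj z) => e; last first.
    by rewrite (Gl e); exists y => //; apply: connect_trans h2 (dihG _ _ _).
  rewrite (Gr e); exists (G2 z) => //; split; first exact: G21.
  apply: connect_trans (dihG _ _ z); apply: connect_trans h1 _.
  case: (eqVneq z y) => [->|/eqP n]; first exact: connect0.
  by rewrite -(contr_uniq FK G1K Gy e h2 n) dihF.
- by exists x; rewrite ?connect0.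
Qed.

Lemma connect_stage x y : G1 x = x -> G1 y = y ->
  connect (dih F1 G2) x y = connect (dih F G) x y.
Proof.
move=> Gx Gy; apply/idP/idP; first exact: dcF1.
case/(reach Gx) => z [Gz h1] h2; apply: connect_trans h1 _.
case: (eqVneq y z) => [->|/eqP n]; first exact: connect0.
by rewrite -(contr_uniq FK G1K Gz Gy h2 n) dihF.
Qed.

Lemma contr_stage x : G x = x -> contr F1 G2 x = contr F G x.
Proof.
move=> Gx; have /andP [/eqP G1x /eqP G2x] : (G1 x == x) && (G2 x == x).
  by rewrite -fixG Gx.
rewrite /contr Gx G2x !eqxx; congr odflt; apply: eq_pick => y /=.
rewrite fixG; case: (eqVneq (G1 y) y) => [e|/eqP n] /=.
  by rewrite (connect_stage G1x e).
rewrite andbF; apply/negbTE/and3P => -[yx G2y xy].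
suff: G1 y = y by [].
by apply: (dih_ind (A := fun y => G1 y = y)) xy => // z h; apply: contr_fixG.
Qed.

(** Separates the components that the first gluing already completes from those that the second one
    still changes. *)
Let touched : pred S := [pred x | [exists y, connect (dih F G) x y && (G2 y != y)]].

Let touched_closed x y : connect (dih F G) x y -> touched x = touched y.
Proof.
move=> xy; apply: eq_existsb => z; congr (_ && _).
by apply: same_connect xy _; apply: dih_sym.
Qed.

Let live := {x : S | G1 x == x}.
Let live_rel : rel live := fun u v => connect (dih F1 G2) (val u) (val v).

Let live_relE : connect live_rel =2 live_rel.
Proof.
move=> u v; apply/idP/idP; last exact: connect1.
case/connectP => p; elim: p u => [|w p IH] u /=; first by move=> _ ->; apply: connect0.
by case/andP => uw /IH h /h; apply: connect_trans.
Qed.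

Let live_sym : connect_sym live_rel.
Proof.
by move=> u v; rewrite !live_relE /live_rel; exact: dih_sym.
Qed.

Let untouched_fix x y : ~~ touched x -> connect (dih F G) x y -> G2 y = y.
Proof.
move=> nt xy; apply: contraNeq nt => h; apply/existsP; exists y; exact/andP.
Qed.

Let untouched_connect x y : ~~ touched x ->
  connect (dih F G) x y = connect (dih F G1) x y.
Proof.
move=> nt; apply/idP/idP; last exact: dcG1.
move=> xy; suff [] : connect (dih F G) x y /\ connect (dih F G1) x y by [].
apply: (dih_ind (A := fun y => connect (dih F G) x y /\ connect (dih F G1) x y)) xy => [z [h1 h2]|z [h1 h2]|]; rewrite ?connect0 //; split.
- exact: connect_trans h1 (dihF _ _ _).
- exact: connect_trans h2 (dihF _ _ _).
- exact: connect_trans h1 (dihG _ _ _).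
- rewrite (Gl (untouched_fix nt h1)); exact: connect_trans h2 (dihG _ _ _).
Qed.

Let untouched_closed b :
  closed (dih F G) [predI inner_orbit F G b & predC touched].
Proof.
move=> x y xy; have h := connect1 xy.
change ((inner_orbit F G b x && ~~ touched x) = (inner_orbit F G b y && ~~ touched y)).
by rewrite (touched_closed h); congr (_ && _); apply: inner_orbit_closed.
Qed.

Let touched_inner_closed b :
  closed (dih F G) [predI inner_orbit F G b & touched].
Proof.
move=> x y xy; have h := connect1 xy.
change ((inner_orbit F G b x && touched x) = (inner_orbit F G b y && touched y)).
by rewrite (touched_closed h); congr (_ && _); apply: inner_orbit_closed.
Qed.

Let count_untouched b :
  n_comp (dih F G) [predI inner_orbit F G b & predC touched] = inner_count F G1 b.
Proof.
have h : rel_adjunction_mem id (dih F G) (dih F G1)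
    (mem [predI inner_orbit F G b & predC touched]).
  split=> [x|x y]; first by exists x; rewrite connect0.
  by case/andP => _ /untouched_connect ->.
rewrite (adjunction_n_comp _ (dih_sym FK GK) (dih_sym FK G1K) (untouched_closed b) h).
apply: eq_n_comp_r => x; rewrite !inE /=.
(* A slot moved by G2 is fixed by G1, and [reach] carries such a fixed point into the G1-orbit of x.
   Hence no part of a touched orbit is inner at the first stage. *)
case: (boolP (touched x)) => [/existsP [y /andP [xy ny]]|nt] /=.
  rewrite andbF; apply/esym/negbTE/nandP; right; rewrite negbK; apply/existsP.
  have Gy : G1 y = y by case: (disj y) => // e; rewrite e eqxx in ny.
  have yx : connect (dih F G) y x by rewrite dih_sym.
  have [y' [Gy' _] h'] := reach Gy yx.
  by exists y'; rewrite Gy' eqxx dih_sym // h'.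
rewrite andbT; congr ((_ == b) && ~~ _); apply: eq_existsb => y.
  by rewrite untouched_connect.
case: (boolP (connect (dih F G) x y)) => [xy|].
  by rewrite -untouched_connect // xy fixG (untouched_fix nt xy) eqxx andbT.
by rewrite untouched_connect // => /negbTE ->.
Qed.

Let live_connect x y : G1 x = x -> connect (dih F1 G2) x y -> G1 y = y.
Proof.
move=> Gx; apply: (dih_ind (A := fun y => G1 y = y)) => // z h.
exact: contr_fixG.
Qed.

Let inner_live b x : G1 x = x ->
  (inner_orbit F G b x && touched x) = inner_orbit F1 G2 b x.
Proof.
move=> Gx; rewrite /inner_orbit /=.
have hF : hasfix F G F x = hasfix F1 G2 F1 x.
  apply/existsP/existsP => -[z /andP [xz /eqP Fz]].
    have [y [Gy xy] yz] := reach Gx xz.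
    exists y; rewrite xy contr_id //; apply/existsP; exists z; rewrite yz Fz; exact: eqxx.
  have Gz := live_connect Gx xz.
  move/eqP: Fz; rewrite contr_id // => /existsP [y /andP [zy Fy]].
  by exists y; rewrite Fy andbT; apply: connect_trans (dcF1 xz) (dcG1 zy).
have hG : hasfix F G G x = hasfix F1 G2 G2 x.
  apply/existsP/existsP => -[z /andP [xz]].
    by rewrite fixG => /andP [/eqP Gz G2z]; exists z; rewrite connect_stage // xz.
  move=> G2z; have Gz := live_connect Gx xz.
  by exists z; rewrite (dcF1 xz) fixG Gz G2z eqxx.
rewrite hF hG; case: (boolP (hasfix F1 G2 G2 x)) => h; rewrite ?andbF //= andbT.
rewrite [touched x](_ : _ = true) ?andbT //.
apply/existsP; exists x; rewrite connect0; apply: contraNneq h => e.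
by apply/existsP; exists x; rewrite connect0 e eqxx.
Qed.

(** Both counts are transported to the slots fixed by G1: every touched orbit contains one, and a
    slot moved by G1 is fixed by G2, so it lies in no inner orbit of the second stage. *)
Let count_touched b :
  n_comp (dih F G) [predI inner_orbit F G b & touched] = inner_count F1 G2 b.
Proof.
have h1 : rel_adjunction_mem (val : live -> S) (dih F G) live_rel
    (mem [predI inner_orbit F G b & touched]).
  split=> [x|[x Gx] [y Gy] _]; last first.
    by rewrite live_relE /live_rel /= connect_stage //; apply/eqP.
  case/andP => _ /existsP h; move: (xchooseP h) => /andP [xy ny].
  have Gy : G1 (xchoose h) == xchoose h.
    by case: (disj (xchoose h)) => [->//|e]; rewrite e eqxx in ny.
  by exists (exist _ (xchoose h) Gy).
have h2 : rel_adjunction_mem (val : live -> S) (dih F1 G2) live_rel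
    (mem (inner_orbit F1 G2 b)).
  split=> [x|x y _]; last by rewrite live_relE.
  rewrite !inE => /andP [_ h].
  have Gx : G1 x == x.
    case: (disj x) => [->//|e]; case/negP: h; apply/existsP; exists x.
    by rewrite connect0 e eqxx.
  by exists (exist _ x Gx); rewrite connect0.
rewrite (adjunction_n_comp _ (dih_sym FK GK) live_sym (touched_inner_closed b) h1).
rewrite /inner_count.
rewrite (adjunction_n_comp _ (dih_sym F1K G2K) live_sym (inner_orbit_closed F1K G2K b) h2).
by apply: eq_n_comp_r => -[x Gx]; apply: inner_live; apply/eqP.
Qed.

Lemma inner_count_stage b :
  inner_count F G b = inner_count F G1 b + inner_count F1 G2 b.
Proof.
rewrite -count_touched -count_untouched addnC /inner_count /n_comp_mem.
rewrite -(cardID touched); congr (_ + _); apply: eq_card => x;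
  by rewrite !inE -?andbA //= [in RHS]andbC -!andbA; do ?bool_congr.
Qed.

End Stages.

(** * Composition of diagrams *)

Definition lf n (i : 'I_n) : vert n := (ord0, i).
Definition rt n (i : 'I_n) : vert n := (ord_max, i).

Lemma vertP n (P : vert n -> Prop) :
  (forall i, P (lf i)) -> (forall i, P (rt i)) -> forall v, P v.
Proof.
move=> Pl Pr [[[|[|//]] lt] i]; [have := Pl i | have := Pr i];
  by congr P; congr pair; apply: val_inj.
Qed.

Lemma lf_inj n : injective (@lf n). Proof. by move=> i j []. Qed.
Lemma rt_inj n : injective (@rt n). Proof. by move=> i j []. Qed.

Definition wcol n (c : nat) (i : 'I_n) : wvert n := (inord c, i).

Lemma wvertP n (P : wvert n -> Prop) :
  (forall i, P (wcol 0 i)) -> (forall i, P (wcol 1 i)) -> (forall i, P (wcol 2 i)) ->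
  forall y, P y.
Proof.
move=> P0 P1 P2 [[[|[|[|//]]] lt] i]; [have := P0 i | have := P1 i | have := P2 i];
  by congr P; congr pair; apply: val_inj; rewrite /= inordK.
Qed.

Lemma wcol_inj n c d (i j : 'I_n) : c < 3 -> d < 3 -> wcol c i = wcol d j -> c = d /\ i = j.
Proof.
by move=> lc ld [e ->]; split => //; move/(congr1 (@nat_of_ord _)): e; rewrite !inordK.
Qed.

Lemma emb1_inj n : injective (@emb1 n).
Proof. by elim/vertP => i; elim/vertP => j e; case: (wcol_inj _ _ e) => //= _ ->. Qed.

Lemma emb2_inj n : injective (@emb2 n).
Proof. by elim/vertP => i; elim/vertP => j e; case: (wcol_inj _ _ e) => //= _ ->. Qed.

Lemma middle_wcol n c (i : 'I_n) : c < 3 -> middle (wcol c i) = (c == 1).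
Proof. by move=> lc; rewrite /middle /= inordK. Qed.

Lemma edge1_exists n (f : {ffun vert n -> vert n}) u :
  [exists w, edge1 f (emb1 u) w] = (f u != u).
Proof.
apply/existsP/idP => [[w /existsP [v /and3P [/eqP /emb1_inj -> //]]]|h].
by exists (emb1 (f u)); apply/existsP; exists u; rewrite !eqxx.
Qed.

Lemma edge2_exists n (f : {ffun vert n -> vert n}) u :
  [exists w, edge2 f (emb2 u) w] = (f u != u).
Proof.
apply/existsP/idP => [[w /existsP [v /and3P [/eqP /emb2_inj -> //]]]|h].
by exists (emb2 (f u)); apply/existsP; exists u; rewrite !eqxx.
Qed.

Lemma crel_emb1 n (f g : {ffun vert n -> vert n}) u :
  connect (crel f g) (emb1 u) (emb1 (f u)).
Proof.
case: (eqVneq (f u) u) => [->|h]; first exact: connect0.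
apply/connect1/orP; left; apply/existsP; exists u; by rewrite !eqxx.
Qed.

Lemma crel_emb2 n (f g : {ffun vert n -> vert n}) u :
  connect (crel f g) (emb2 u) (emb2 (g u)).
Proof.
case: (eqVneq (g u) u) => [->|h]; first exact: connect0.
apply/connect1/orP; right; apply/existsP; exists u; by rewrite !eqxx.
Qed.

(** S may contain more slots than the two diagrams, namely those consumed by an earlier contraction,
    so the same interface serves the second stage of a triple product. The last field keeps G from
    moving the extra slots, which therefore add no inner orbit. *)
Record gluing n (f g : {ffun vert n -> vert n}) (S : finType) (F G : S -> S)
    (i1 i2 : vert n -> S) : Prop := Gluing {
  gluing_FK : involutive F;
  gluing_GK : involutive G;
  gluing_inj1 : injective i1;
  gluing_inj2 : injective i2;
  gluing_disj : forall u v, i1 u <> i2 v;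
  gluing_F1 : forall u, F (i1 u) = i1 (f u);
  gluing_F2 : forall u, F (i2 u) = i2 (g u);
  gluing_G1l : forall i, G (i1 (lf i)) = i1 (lf i);
  gluing_G1r : forall i, G (i1 (rt i)) = i2 (lf i);
  gluing_G2r : forall i, G (i2 (rt i)) = i2 (rt i);
  gluing_moved : forall s, G s <> s -> exists i, s = i1 (rt i) \/ s = i2 (lf i)
}.

(** * The three-column graph versus orbits of slots *)

Section Bridge.
Variables (n : nat) (f g : {ffun vert n -> vert n}).
Variables (S : finType) (F G : S -> S) (i1 i2 : vert n -> S).
Hypothesis glued : gluing f g F G i1 i2.

Let FK := gluing_FK glued.
Let GK := gluing_GK glued.
Let inj1 := gluing_inj1 glued.
Let inj2 := gluing_inj2 glued.
Let i12 := gluing_disj glued.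
Let F1 := gluing_F1 glued.
Let F2 := gluing_F2 glued.
Let G1l := gluing_G1l glued.
Let G1r := gluing_G1r glued.
Let G2r := gluing_G2r glued.
Let Gfix := gluing_moved glued.

Let G2l i : G (i2 (lf i)) = i1 (rt i).
Proof. by rewrite -G1r GK. Qed.

(** A middle vertex has two slots, exchanged by G; the one in the left diagram represents it. *)
Definition wslot (y : wvert n) : S :=
  if (y.1 : nat) == 0 then i1 (lf y.2)
  else if (y.1 : nat) == 1 then i1 (rt y.2) else i2 (rt y.2).

Let wslot0 i : wslot (wcol 0 i) = i1 (lf i). Proof. by rewrite /wslot /= inordK. Qed.
Let wslot1 i : wslot (wcol 1 i) = i1 (rt i). Proof. by rewrite /wslot /= inordK. Qed.
Let wslot2 i : wslot (wcol 2 i) = i2 (rt i). Proof. by rewrite /wslot /= inordK. Qed.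

Let fK u : f (f u) = u. Proof. by apply: inj1; rewrite -!F1 FK. Qed.
Let gK u : g (g u) = u. Proof. by apply: inj2; rewrite -!F2 FK. Qed.

Let dsym := dih_sym FK GK.

Let wslot_emb1 u : wslot (emb1 u) = i1 u.
Proof. by elim/vertP: u => i; rewrite [emb1 _]/(wcol _ i) ?wslot0 ?wslot1. Qed.

Let wslot_emb2 u : connect (dih F G) (wslot (emb2 u)) (i2 u).
Proof.
elim/vertP: u => i; rewrite [emb2 _]/(wcol _ i) ?wslot1 ?wslot2; last exact: connect0.
by rewrite -G1r dihG.
Qed.

Let crel_dih y z : connect (crel f g) y z -> connect (dih F G) (wslot y) (wslot z).
Proof.
case/connectP => p; elim: p y => [|w p IH] y /=; first by move=> _ ->; apply: connect0.
case/andP => yw hp hz; apply: connect_trans (IH _ hp hz).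
case/orP: yw => /existsP [u /and3P [/eqP <- /eqP <- _]].
  by rewrite !wslot_emb1 -F1 dihF.
apply: connect_trans (wslot_emb2 _) _; rewrite dsym.
by apply: connect_trans (wslot_emb2 _) _; rewrite -F2 dsym dihF.
Qed.

Let slot_crel y s : connect (dih F G) (wslot y) s ->
  (forall u, s = i1 u -> connect (crel f g) y (emb1 u)) /\
  (forall u, s = i2 u -> connect (crel f g) y (emb2 u)).
Proof.
move=> ys; apply: (dih_ind (A := fun s =>
  (forall u, s = i1 u -> connect (crel f g) y (emb1 u)) /\
  (forall u, s = i2 u -> connect (crel f g) y (emb2 u)))) ys => [{}s [h1 h2]|{}s [h1 h2]|].
- split=> u /(congr1 F); rewrite FK ?F1 ?F2 => e.
    by apply: connect_trans (h1 _ e) _; rewrite -{2}(fK u) crel_emb1.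
  by apply: connect_trans (h2 _ e) _; rewrite -{2}(gK u) crel_emb2.
- split; elim/vertP => i /(congr1 G); rewrite GK ?G1l ?G1r ?G2l ?G2r.
  + exact: h1.
  + exact: h2.
  + exact: h1.
  + exact: h2.
- elim/wvertP: y => i; rewrite ?wslot0 ?wslot1 ?wslot2; split=> u.
  + by move/inj1 <-; apply: connect0.
  + by move/i12.
  + by move/inj1 <-; apply: connect0.
  + by move/i12.
  + by move/esym/i12.
  + by move/inj2 <-; apply: connect0.
Qed.

Lemma connect_wslot y z : connect (dih F G) (wslot y) (wslot z) = connect (crel f g) y z.
Proof.
apply/idP/idP => [h|]; last exact: crel_dih.
have [h1 h2] := slot_crel h.
elim/wvertP: z h h1 h2 => i; rewrite ?wslot0 ?wslot1 ?wslot2 => _ h1 h2.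
- exact: (h1 (lf i)).
- exact: (h1 (rt i)).
- exact: (h2 (rt i)).
Qed.

Let csym : connect_sym (crel f g).
Proof. by move=> y z; rewrite -!connect_wslot dsym. Qed.

Let oslot v := wslot (outer v).

Let oslot_lf i : oslot (lf i) = i1 (lf i). Proof. exact: wslot0. Qed.
Let oslot_rt i : oslot (rt i) = i2 (rt i). Proof. exact: wslot2. Qed.

Let oslot_fix v : G (oslot v) = oslot v.
Proof. by elim/vertP: v => i; rewrite ?oslot_lf ?oslot_rt. Qed.

Let oslot_inj : injective oslot.
Proof.
elim/vertP => i; elim/vertP => j; rewrite ?oslot_lf ?oslot_rt.
- exact: inj1.
- by move/i12.
- by move/esym/i12.
- exact: inj2.
Qed.

Let in_image y s : connect (dih F G) (wslot y) s -> (exists u, s = i1 u) \/ (exists u, s = i2 u).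
Proof.
move=> ys; apply: (dih_ind (A := fun s => (exists u, s = i1 u) \/ (exists u, s = i2 u))) ys.
- by move=> z [] [u ->]; [left|right]; rewrite ?F1 ?F2; eexists.
- by move=> z [] []; elim/vertP => i ->; rewrite ?G1l ?G1r ?G2l ?G2r;
    (try by left; eexists); by right; eexists.
- by elim/wvertP: y => i; rewrite ?wslot0 ?wslot1 ?wslot2;
    (try by left; eexists); by right; eexists.
Qed.

Let fixed_outer y s : connect (dih F G) (wslot y) s -> G s = s -> exists v, s = oslot v.
Proof.
move=> /in_image [] []; elim/vertP => i ->; rewrite ?G1l ?G1r ?G2l ?G2r => e.
- by exists (lf i).
- by case: (i12 (esym e)).
- by case: (i12 e).
- by exists (rt i).
Qed.

(** The [pick] in [compose] is unambiguous because an orbit contains at most two fixed points of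
    G. *)
Lemma contr_wslot v : contr F G (wslot (outer v)) = wslot (outer (compose f g v)).
Proof.
rewrite -/(oslot _) -[wslot _]/(oslot _) ffunE; case: pickP => /= [u /andP [uv vu]|h].
  apply: contr_uniq => //; first by rewrite connect_wslot.
  by move/oslot_inj => e; rewrite e eqxx in uv.
case: (eqVneq (contr F G (oslot v)) (oslot v)) => // /eqP nv.
have [] := fixed_outer (contr_connect F G (oslot v)) (contr_fixG F (oslot_fix v)).
move=> u e; move: (h u); rewrite -connect_wslot -[wslot (outer u)]/(oslot u) -e contr_connect.
rewrite andbT => /negbFE/eqP uv; by case: nv; rewrite e uv.
Qed.

Let middle_compE y : middle_comp f g y = ~~ hasfix F G G (wslot y).
Proof.
apply/forallP/existsPn => [h s|h z].
  apply/negP => /andP [ys /eqP Gs]; have [v e] := fixed_outer ys Gs.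
  move: (h (outer v)); rewrite -connect_wslot -/(oslot v) -e ys /=.
  by elim/vertP: v {e} => i; rewrite [outer _]/(wcol _ i) middle_wcol.
apply/implyP => yz; move: (h (wslot z)); rewrite connect_wslot yz /= => nz.
elim/wvertP: z {yz} nz => i; rewrite middle_wcol //.
  by rewrite wslot0 G1l eqxx.
by rewrite wslot2 G2r eqxx.
Qed.

Let loop_compE y : middle_comp f g y -> loop_comp f g y = ~~ hasfix F G F (wslot y).
Proof.
move=> my; rewrite /loop_comp my /=; apply/forallP/existsPn => [h s|h z].
  apply/negP => /andP [ys /eqP Fs]; have [s1 s2] := slot_crel ys.
  case: (in_image ys) => -[u e].
    have yu := s1 _ e; move: (h (emb1 u)); rewrite yu edge1_exists => /andP [/eqP fu _].
    by apply/fu/inj1; rewrite -F1 -e.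
  have yu := s2 _ e; move: (h (emb2 u)); rewrite yu edge2_exists => /andP [_ /eqP gu].
  by apply/gu/inj2; rewrite -F2 -e.
apply/implyP => yz; move/forallP/(_ z)/implyP/(_ yz): my.
elim/wvertP: z yz => i yz; rewrite middle_wcol // => _.
have -> : [exists w, edge1 f (wcol 1 i) w].
  rewrite [wcol 1 i]/(emb1 (rt i)) edge1_exists.
  move: (h (i1 (rt i))); rewrite -wslot1 connect_wslot yz wslot1 F1 /=.
  by apply: contraNneq => ->.
rewrite [wcol 1 i]/(emb2 (lf i)) edge2_exists.
move: (h (i2 (lf i))); rewrite F2 -G1r (connect_trans _ (dihG F G _)) ?G1r /=.
  by apply: contraNneq => ->.
by rewrite -wslot1 connect_wslot.
Qed.

(** G moves every slot of an inner orbit, so all of them lie over the middle column, and components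
    may be counted on vertices or on slots. *)
Let count_adj b : n_comp (crel f g) [preim wslot of inner_orbit F G b] = inner_count F G b.
Proof.
apply/esym/(adjunction_n_comp _ dsym csym (inner_orbit_closed FK GK b)).
split=> [s|y z _]; last by rewrite connect_wslot.
case/andP => _ hs; have Gs : G s <> s.
  move=> e; case/negP: hs; apply/existsP; exists s; by rewrite connect0 e eqxx.
have h : exists y, connect (dih F G) s (wslot y).
  have [i []] := Gfix Gs => ->; exists (wcol 1 i); rewrite wslot1 ?connect0 //.
  by rewrite -G2l dihG.
by exists (xchoose h); apply: (xchooseP h).
Qed.

Lemma comp_alpha_count : comp_alpha f g = inner_count F G false.
Proof.
rewrite -count_adj /comp_alpha cardsE; apply: eq_card => y.
rewrite !inE /= /roots /inner_orbit /=; congr (_ && _).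
case: (boolP (middle_comp f g y)) => my; last first.
  by rewrite /loop_comp (negbTE my) -middle_compE (negbTE my) andbF.
by rewrite loop_compE // -middle_compE my andbT; case: hasfix.
Qed.

Lemma comp_beta_count : comp_beta f g = inner_count F G true.
Proof.
rewrite -count_adj /comp_beta cardsE; apply: eq_card => y.
rewrite !inE /= /roots /inner_orbit /=; congr (_ && _).
case: (boolP (middle_comp f g y)) => my; last by rewrite -middle_compE (negbTE my) andbF.
by rewrite loop_compE // -middle_compE my andbT; case: hasfix.
Qed.

Definition ends v : S := if v.1 == ord0 then i1 v else i2 v.

Let ends_outer v : wslot (outer v) = ends v.
Proof. by elim/vertP: v => i; rewrite ?wslot0 ?wslot2. Qed.

Lemma contr_ends v : contr F G (ends v) = ends (compose f g v).
Proof. by rewrite -!ends_outer contr_wslot. Qed.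

Lemma ends_inj : injective ends.
Proof. by move=> u v; rewrite -!ends_outer; apply: oslot_inj. Qed.

Lemma ends_fix v : G (ends v) = ends v.
Proof. by rewrite -!ends_outer; apply: oslot_fix. Qed.

Lemma compose_involutive : involutive (compose f g).
Proof. by move=> v; apply: ends_inj; rewrite -!contr_ends contrK. Qed.

Lemma compose_connect v u : u <> v -> connect (dih F G) (ends v) (ends u) -> compose f g v = u.
Proof.
move=> uv vu; apply: ends_inj; rewrite -contr_ends.
by apply: contr_uniq; rewrite ?ends_fix // => /ends_inj.
Qed.

Lemma compose_isolated v : hasfix F G F (ends v) -> compose f g v = v.
Proof.
move=> h; apply: ends_inj; rewrite -contr_ends; apply/eqP.
by rewrite contr_id // ends_fix.
Qed.

End Bridge.

(** * Slots of a family of diagrams *)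

Section Slots.
Variables (n : nat) (I : finType) (D : I -> {ffun vert n -> vert n}).
Hypothesis DK : forall a, involutive (D a).

Definition diag_slot (s : I * vert n) : I * vert n := (s.1, D s.1 s.2).

Definition glue (a b : I) (s : I * vert n) : I * vert n :=
  if s == (a, rt s.2.2) then (b, lf s.2.2)
  else if s == (b, lf s.2.2) then (a, rt s.2.2) else s.

Lemma glue_lf a b c i : glue a b (c, lf i) = if c == b then (a, rt i) else (c, lf i).
Proof.
rewrite /glue /=; case: eqP => [[]//|_]; case: (c =P b) => [->|h]; first by rewrite eqxx.
by case: eqP => // -[/h].
Qed.

Lemma glue_rt a b c i : glue a b (c, rt i) = if c == a then (b, lf i) else (c, rt i).
Proof.
rewrite /glue /=; case: (c =P a) => [->|h]; first by rewrite eqxx.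
by case: eqP => [[/h]//|_]; case: eqP => // -[].
Qed.

Lemma diag_slotK : involutive diag_slot.
Proof. by move=> [a v]; rewrite /diag_slot /= DK. Qed.

Lemma glueK a b : involutive (glue a b).
Proof.
move=> [c]; elim/vertP => i; rewrite !(glue_lf, glue_rt).
  by case: eqP => [->|/eqP/negbTE e]; rewrite !(glue_lf, glue_rt) ?eqxx ?e.
by case: eqP => [->|/eqP/negbTE e]; rewrite !(glue_lf, glue_rt) ?eqxx ?e.
Qed.

Lemma glue_moved a b s : glue a b s <> s -> exists i, s = (a, rt i) \/ s = (b, lf i).
Proof.
case: s => c; elim/vertP => i; rewrite !(glue_lf, glue_rt); case: eqP => // -> _; exists i; tauto.
Qed.

Lemma slot_gluing a b : a <> b -> gluing (D a) (D b) diag_slot (glue a b) (pair a) (pair b).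
Proof.
move=> ab; split=> //; try by move=> u v [].
- exact: diag_slotK.
- exact: glueK.
- by move=> i; rewrite glue_lf; case: eqP.
- by move=> i; rewrite glue_rt eqxx.
- by move=> i; rewrite glue_rt; case: eqP => // /esym.
- exact: glue_moved.
Qed.

End Slots.

Section TwoDiagrams.
Variables (n : nat) (f g : {ffun vert n -> vert n}).
Hypotheses (fK : involutive f) (gK : involutive g).

Definition pair_slot : bool * vert n -> bool * vert n := diag_slot (fun b => if b then g else f).
Definition mid_glue : bool * vert n -> bool * vert n := glue false true.
Definition outer_slot (v : vert n) : bool * vert n := (v.1 != ord0, v).

Let ends_outer v : ends (pair false) (pair true) v = outer_slot v.
Proof. by elim/vertP: v. Qed.

Lemma pair_gluing : gluing f g pair_slot mid_glue (pair false) (pair true).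
Proof. by apply: (@slot_gluing n _ (fun b => if b then g else f) _ false true) => // -[]. Qed.

Lemma pair_composeK : involutive (compose f g).
Proof. exact: (compose_involutive pair_gluing). Qed.

Lemma pair_connect v u : u <> v ->
  connect (dih pair_slot mid_glue) (outer_slot v) (outer_slot u) -> compose f g v = u.
Proof. by rewrite -!ends_outer; apply: (compose_connect pair_gluing). Qed.

Lemma pair_isolated v : hasfix pair_slot mid_glue pair_slot (outer_slot v) ->
  compose f g v = v.
Proof. by rewrite -!ends_outer; apply: (compose_isolated pair_gluing). Qed.

Lemma contr_outer v : contr pair_slot mid_glue (outer_slot v) = outer_slot (compose f g v).
Proof. by rewrite -!ends_outer; apply: (contr_ends pair_gluing). Qed.

End TwoDiagrams.

(** * Associativity of the product and of the loop counts *)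

Section Associativity.
Variables (n : nat) (d1 d2 d3 : {ffun vert n -> vert n}).
Hypotheses (d1K : involutive d1) (d2K : involutive d2) (d3K : involutive d3).

Let D (x : option bool) := if x is Some b then if b then d3 else d2 else d1.
Let DK x : involutive (D x). Proof. by case: x => [[]|]. Qed.
Let F := diag_slot D.
Let FK : involutive F := diag_slotK DK.
Let G12 := @glue n _ None (Some false).
Let G23 := @glue n _ (Some false) (Some true).
Let G s := if G12 s == s then G23 s else G12 s.
Let G12K : involutive G12 := glueK _ _.
Let G23K : involutive G23 := glueK _ _.

Let GK : involutive G.
Proof.
move=> [[[]|]]; elim/vertP => i; rewrite /G /G12 /G23;
  by do 2! rewrite ?(glue_lf, glue_rt) /= ?eqxx ?xpair_eqE //=.
Qed.

Let disj s : G12 s = s \/ G23 s = s.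
Proof.
by case: s => [[[]|]]; elim/vertP => i; rewrite /G12 /G23 ?(glue_lf, glue_rt) /=; auto.
Qed.

Let disj' s : G23 s = s \/ G12 s = s.
Proof. by case: (disj s); auto. Qed.

Let Gl s : G23 s = s -> G s = G12 s.
Proof. by rewrite /G; case: eqP => // -> ->. Qed.

Let Gr s : G12 s = s -> G s = G23 s.
Proof. by rewrite /G => ->; rewrite eqxx. Qed.

Let o := @ends n _ (pair (None : option bool)) (pair (Some true)).

Let ofix v : G (o v) = o v.
Proof.
by elim/vertP: v => i; rewrite /G /G12 /G23 /o /ends /= ?(glue_lf, glue_rt) /= eqxx.
Qed.

Let o_inj : injective o.
Proof. by elim/vertP => i; elim/vertP => j [] // ->. Qed.

Let o12 := @ends n _ (pair (None : option bool)) (pair (Some false)).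
Let o23 := @ends n _ (pair (Some false)) (pair (Some true)).


Let glued12 : gluing d1 d2 F G12 (pair None) (pair (Some false)).
Proof. exact: (@slot_gluing n _ D DK None (Some false)). Qed.

Let glued23 : gluing d2 d3 F G23 (pair (Some false)) (pair (Some true)).
Proof. exact: (@slot_gluing n _ D DK (Some false) (Some true)). Qed.

(** The slots between d1 and d2 remain in S as fixed points of the contracted involution. No slot of
    d3 is moved by G12, so [contr_step] leaves d3 as it is. *)
Let glued12_3 : gluing (compose d1 d2) d3 (contr F G12) G23 o12 (pair (Some true)).
Proof.
split=> //.
- exact: contrK.
- by elim/vertP => i; elim/vertP => j [] // ->.
- by move=> u v [].
- by elim/vertP.
- exact: (contr_ends glued12).
- by move=> u; apply: contr_step.
- exact: (gluing_G1r glued23).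
- by move=> s /glue_moved.
Qed.

Let glued1_23 : gluing d1 (compose d2 d3) (contr F G23) G12 (pair None) o23.
Proof.
split=> //.
- exact: contrK.
- by move=> u v [].
- by elim/vertP => i; elim/vertP => j [] // ->.
- by move=> u; elim/vertP.
- by move=> u; apply: contr_step.
- exact: (contr_ends glued23).
- exact: (gluing_G1r glued12).
- by move=> s /glue_moved.
Qed.

Lemma composeA : compose d1 (compose d2 d3) = compose (compose d1 d2) d3.
Proof.
apply/ffunP => v; apply: o_inj.
have o1 u : ends o12 (pair (Some true)) u = o u by elim/vertP: u.
have o2 u : ends (pair None) o23 u = o u by elim/vertP: u.
have e1 := contr_ends glued12_3 v; have e2 := contr_ends glued1_23 v.
rewrite !o1 in e1; rewrite !o2 in e2.
have s1 := contr_stage FK G12K G23K disj Gl Gr (ofix v).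
have s2 := contr_stage FK G23K G12K disj' Gr Gl (ofix v).
exact: etrans (esym e2) (etrans s2 (etrans (esym s1) e1)).
Qed.

Let count_assoc b :
  inner_count F G12 b + inner_count (contr F G12) G23 b =
  inner_count F G23 b + inner_count (contr F G23) G12 b.
Proof.
have s1 := inner_count_stage FK GK G12K G23K disj Gl Gr b.
have s2 := inner_count_stage FK GK G23K G12K disj' Gr Gl b.
exact: etrans (esym s1) s2.
Qed.

Lemma comp_alphaA :
  comp_alpha d1 d2 + comp_alpha (compose d1 d2) d3 =
  comp_alpha d2 d3 + comp_alpha d1 (compose d2 d3).
Proof.
rewrite (comp_alpha_count glued12) (comp_alpha_count glued12_3).
by rewrite (comp_alpha_count glued23) (comp_alpha_count glued1_23).
Qed.

Lemma comp_betaA :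
  comp_beta d1 d2 + comp_beta (compose d1 d2) d3 =
  comp_beta d2 d3 + comp_beta d1 (compose d2 d3).
Proof.
rewrite (comp_beta_count glued12) (comp_beta_count glued12_3).
by rewrite (comp_beta_count glued23) (comp_beta_count glued1_23).
Qed.

End Associativity.

(** * Planarity of the composition *)

Lemma bpos_lf n (i : 'I_n) : bpos (lf i) = i.
Proof. by []. Qed.

Lemma bpos_rt n (i : 'I_n) : bpos (rt i) = (2 * n).-1 - i.
Proof. by []. Qed.

Lemma bpos_inj n : injective (@bpos n).
Proof.
elim/vertP => i; elim/vertP => j; rewrite ?bpos_lf ?bpos_rt => e;
  have := ltn_ord i; have := ltn_ord j => lj li.
- by congr lf; apply: val_inj.
- lia.
- lia.
- by congr rt; apply: val_inj => /=; lia.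
Qed.

Lemma sum_vert n (P : pred (vert n)) (h : vert n -> nat) :
  \sum_(u | P u) h u = \sum_(i | P (lf i)) h (lf i) + \sum_(i | P (rt i)) h (rt i).
Proof.
rewrite big_mkcond /= (big_mkcond (fun i => P (lf i))) (big_mkcond (fun i => P (rt i))) /=.
rewrite (eq_bigr (fun u => if P (u.1, u.2) then h (u.1, u.2) else 0)); last by case.
rewrite -(pair_bigA _ (fun c i => if P (c, i) then h (c, i) else 0)) /=.
rewrite big_ord_recl big_ord_recl big_ord0 addn0; congr (_ + _); apply: eq_bigr => i _.
by rewrite [(_, i)](_ : _ = rt i) //; congr pair; apply: val_inj.
Qed.

Lemma sum_pairing n (f : vert n -> vert n) (X : pred (vert n)) (h : vert n -> nat) :
  involutive f -> (forall u, X u -> X (f u)) -> (forall u, X u -> f u != u) ->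
  \sum_(u | X u) h u = \sum_(u | X u && (bpos u < bpos (f u))) (h u + h (f u)).
Proof.
move=> fK Xf Xn; rewrite (bigID (fun u => bpos u < bpos (f u))) /= big_split /=; congr (_ + _).
rewrite (reindex_inj (can_inj fK)) /=; apply: eq_bigl => u; rewrite fK.
have Xe : X (f u) = X u by apply/idP/idP => /Xf //; rewrite fK.
rewrite Xe; case: (boolP (X u)) => //= Xu; rewrite -leqNgt leq_eqVlt.
by rewrite (inj_eq (@bpos_inj n)) eq_sym (negbTE (Xn u Xu)).
Qed.

Definition lower_pairs n (X Y : pred 'I_n) := \sum_(i | X i) \sum_(j | Y j) (i < j : nat).
Definition upper_pairs n (X Y : pred 'I_n) := \sum_(i | X i) \sum_(j | Y j) (j < i : nat).

Lemma lower_upper n (X Y : pred 'I_n) : (forall i, X i -> ~~ Y i) ->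
  lower_pairs X Y + upper_pairs X Y = #|X| * #|Y|.
Proof.
move=> d; rewrite /lower_pairs /upper_pairs -big_split /= -sum_nat_const.
apply: eq_bigr => i Xi; rewrite -big_split /= -sum1_card; apply: eq_bigr => j Yj.
case: (ltngtP i j) => // /val_inj e; move: (d i Xi); by rewrite e [Y j]Yj.
Qed.

Definition boundary_pairs n (X Y : pred (vert n)) :=
  \sum_(u | X u) \sum_(v | Y v) (bpos u < bpos v : nat).

(** Left positions precede all right ones, whence the product, and the right column is traversed
    upwards, whence the reversed order in the last term. *)
Lemma boundary_pairs_split n (X Y : pred (vert n)) :
  boundary_pairs X Y =
  lower_pairs [pred i | X (lf i)] [pred i | Y (lf i)]
  + #|[pred i | X (lf i)]| * #|[pred i | Y (rt i)]|
  + upper_pairs [pred i | X (rt i)] [pred i | Y (rt i)].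
Proof.
rewrite /boundary_pairs sum_vert -addnA; rewrite -sum_nat_const addnA -big_split /=; congr (_ + _).
  apply: eq_bigr => i _; rewrite sum_vert; congr (_ + _).
  rewrite -sum1_card; apply: eq_bigr => j _; rewrite bpos_lf bpos_rt.
  by have := ltn_ord i; have := ltn_ord j; lia.
apply: eq_bigr => i _; rewrite sum_vert big1 => [|j _].
  rewrite add0n; apply: eq_bigr => j _; rewrite !bpos_rt.
  by have := ltn_ord i; have := ltn_ord j; lia.
by rewrite bpos_lf bpos_rt; have := ltn_ord i; have := ltn_ord j; lia.
Qed.

Lemma odd_sum (T : finType) (X : pred T) (h : T -> nat) :
  (forall u, X u -> ~~ odd (h u)) -> ~~ odd (\sum_(u | X u) h u).
Proof.
by move=> H; elim/big_rec: _ => // u m Xu IH; rewrite oddD (negbTE (H u Xu)).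
Qed.

(** * Parity of crossings *)

Section EvenCrossings.
Variables (n : nat) (f : {ffun vert n -> vert n}).
Hypotheses (fK : involutive f) (fP : planar f).

Lemma even_closed_card (X : pred (vert n)) :
  (forall u, X u -> X (f u)) -> (forall u, X u -> f u != u) ->
  ~~ odd (#|[pred i | X (lf i)]| + #|[pred i | X (rt i)]|).
Proof.
move=> Xf Xn; rewrite -!sum1_card -(sum_vert X (fun=> 1)) (sum_pairing _ fK Xf Xn).
exact: odd_sum.
Qed.

(* Chords {p,q} and {r,s} with distinct ends cross iff
   [p<r] + [p<s] + [q<r] + [q<s] is odd. *)
Lemma even_boundary_pairs (X Y : pred (vert n)) :
  (forall u, X u -> X (f u)) -> (forall u, X u -> f u != u) ->
  (forall u, Y u -> Y (f u)) -> (forall u, Y u -> f u != u) ->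
  (forall u, X u -> ~~ Y u) -> ~~ odd (boundary_pairs X Y).
Proof.
move=> Xf Xn Yf Yn d; rewrite /boundary_pairs (sum_pairing _ fK Xf Xn).
apply: odd_sum => u /andP [Xu u_lt]; rewrite -big_split /= (sum_pairing _ fK Yf Yn).
apply: odd_sum => v /andP [Yv v_lt].
have ne a b : X a -> Y b -> bpos a != bpos b.
  move=> Xa Yb; apply/eqP => /bpos_inj e; move: (d a Xa); by rewrite e Yb.
have n1 := ne _ _ Xu Yv; have n2 := ne _ _ Xu (Yf _ Yv).
have n3 := ne _ _ (Xf _ Xu) Yv; have n4 := ne _ _ (Xf _ Xu) (Yf _ Yv).
have c1 : ~~ chords_cross (bpos u) (bpos (f u)) (bpos v) (bpos (f v)).
  by move/forallP/(_ u)/forallP/(_ v)/implyP: fP; apply; rewrite (Xn u Xu) (Yn v Yv).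
(* [chords_cross] tests only one of the two interleaved orders, so the swapped pair is needed
   too. *)
have c2 : ~~ chords_cross (bpos v) (bpos (f v)) (bpos u) (bpos (f u)).
  by move/forallP/(_ v)/forallP/(_ u)/implyP: fP; apply; rewrite (Xn u Xu) (Yn v Yv).
move: c1 c2; rewrite /chords_cross; move: u_lt v_lt n1 n2 n3 n4.
move: (bpos u) (bpos (f u)) (bpos v) (bpos (f v)) => p q r s; lia.
Qed.

End EvenCrossings.

Section Planarity.
Variables (n : nat) (f g : {ffun vert n -> vert n}).
Hypotheses (fK : involutive f) (gK : involutive g) (fP : planar f) (gP : planar g).

Let F := pair_slot f g.
Let G := @mid_glue n.
Let GK : involutive G := glueK _ _.
Let FK : involutive F. Proof. by apply: diag_slotK => -[]. Qed.
Let h := compose f g.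
Let A x s := connect (dih F G) (outer_slot x) s.

Let A_end x v : h x != x -> A x (outer_slot v) = (v == x) || (v == h x).
Proof.
move=> hx; apply/idP/orP => [xv|[/eqP ->|/eqP ->]].
- case: (eqVneq v x) => [|/eqP nv]; [by left|right].
  by rewrite /h (pair_connect fK gK nv xv).
- exact: connect0.
- by rewrite /A /h -(contr_outer fK gK) contr_connect.
Qed.

Let A_free x s : h x != x -> A x s -> F s != s.
Proof.
move=> hx xs; apply/eqP => Fs; case/negP: hx; apply/eqP; apply: (pair_isolated fK gK).
by apply/existsP; exists s; rewrite -/F -/G Fs eqxx andbT.
Qed.

Let AF x s : A x s -> A x (F s).
Proof. by move=> h1; apply: connect_trans h1 (dihF _ _ _). Qed.

Let AG x s : A x s -> A x (G s).
Proof. by move=> h1; apply: connect_trans h1 (dihG _ _ _). Qed.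

Let A_mid x i : A x (true, lf i) = A x (false, rt i).
Proof.
by apply/idP/idP => /AG; rewrite /G /mid_glue ?(glue_lf, glue_rt).
Qed.

Let sum2 (x y : vert n) (k : vert n -> nat) : y != x ->
  \sum_(v | (v == x) || (v == y)) k v = k x + k y.
Proof.
move=> yx; rewrite (bigD1 x) ?eqxx //= (bigD1 y) ?eqxx ?orbT //=.
rewrite big1 ?addn0 // => v /andP [/andP [/orP [] /eqP ->]]; by rewrite ?eqxx ?andbF.
Qed.

(** Rather than following paths, the proof counts crossings of the components of x and y modulo 2.
    The counts in f and in g are even. In their sum the comparisons within the middle column occur
    once in each order and add up to |M x| |M y|. Since |L|, |M| and |R| have equal parity for each
    component, what remains is the count for the outer ends. *)
Lemma compose_planar : planar (compose f g).
Proof.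
apply/forallP => x; apply/forallP => y; apply/implyP => /andP [hx hy]; rewrite -/h.
case: (boolP (A x (outer_slot y))) => [|nxy].
  rewrite A_end // => /orP [] /eqP ->.
    by rewrite /chords_cross; lia.
  rewrite /h pair_composeK //; by rewrite /chords_cross; lia.
have disj s : A x s -> ~~ A y s.
  move=> xs; apply: contraNN nxy => ys; apply: connect_trans xs _.
  by rewrite dih_sym.
pose slice z b : pred (vert n) := fun v => A z (b, v).
have sF z b u : slice z b u -> slice z b ((if b then g else f) u) by exact: AF.
have sn z b : h z != z -> forall u, slice z b u -> (if b then g else f) u != u.
  move=> hz u /(A_free hz); rewrite /F /pair_slot /diag_slot /= xpair_eqE eqxx.
  by case: b.
have pf := even_boundary_pairs fK fP (sF x false) (sn x false hx) (sF y false) (sn y false hy)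
  (fun u => disj (false, u)).
have pg := even_boundary_pairs gK gP (sF x true) (sn x true hx) (sF y true) (sn y true hy)
  (fun u => disj (true, u)).
have c1 := even_closed_card fK (sF x false) (sn x false hx).
have c2 := even_closed_card gK (sF x true) (sn x true hx).
have c3 := even_closed_card fK (sF y false) (sn y false hy).
have c4 := even_closed_card gK (sF y true) (sn y true hy).
pose out z : pred (vert n) := fun v => A z (outer_slot v).
have po : ~~ odd (boundary_pairs (out x) (out y)).
  pose L z := [pred i | A z (false, lf i)]; pose M z := [pred i | A z (false, rt i)].
  pose R z := [pred i | A z (true, rt i)].
  have lm : lower_pairs [pred i | slice x true (lf i)] [pred i | slice y true (lf i)] =
            lower_pairs (M x) (M y).
    rewrite /lower_pairs; apply: eq_big => [i|i _]; first exact: A_mid.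
    by apply: eq_bigl => j; apply: A_mid.
  have cm z : #|[pred i | slice z true (lf i)]| = #|M z|.
    by apply: eq_card => i; apply: A_mid.
  have lu : lower_pairs (M x) (M y) + upper_pairs (M x) (M y) = #|M x| * #|M y|.
    by apply: lower_upper => i; apply: disj.
  rewrite boundary_pairs_split -/(L x) -/(L y) -/(R x) -/(R y).
  rewrite boundary_pairs_split -/(L x) -/(L y) -/(M x) -/(M y) in pf.
  rewrite boundary_pairs_split -/(R x) -/(R y) lm cm in pg.
  rewrite -/(L x) -/(M x) in c1; rewrite -/(L y) -/(M y) in c3.
  rewrite cm -/(R x) in c2; rewrite cm -/(R y) in c4.
  move: (congr1 odd lu) pf pg c1 c2 c3 c4; rewrite !oddD !oddM.
  move: (odd (lower_pairs (L x) (L y))) (odd (upper_pairs (R x) (R y))).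
  move: (odd (lower_pairs (M x) (M y))) (odd (upper_pairs (M x) (M y))).
  move: (odd #|L x|) (odd #|L y|) (odd #|M x|) (odd #|M y|) (odd #|R x|) (odd #|R y|).
  by do 10! case.
rewrite /boundary_pairs in po.
(* Only z and h z lie in [out z], so the count becomes the four-term sum whose parity detects a
   crossing. *)
have e2 z k : h z != z -> \sum_(v | out z v) k v = k z + k (h z).
  by move=> hz; rewrite -sum2 //; apply: eq_bigl => v; rewrite /out A_end.
rewrite e2 // !e2 // in po; move: po; rewrite /chords_cross.
move: (bpos x) (bpos (h x)) (bpos y) (bpos (h y)) => p q r s; lia.
Qed.

End Planarity.

(** * Corners of Motzkin diagrams *)

Lemma vert_cases n (v : vert n) : (exists i, v = lf i) \/ (exists i, v = rt i).
Proof. by elim/vertP: v => i; [left|right]; exists i. Qed.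

(** * Short paths through a composite *)

Section LocalProducts.
Variables (n : nat) (f g : {ffun vert n -> vert n}).
Hypotheses (fK : involutive f) (gK : involutive g).

Let F := pair_slot f g.
Let G := @mid_glue n.
Let link := connect (dih F G).

Let stepF b u : link (b, u) (b, (if b then g else f) u).
Proof. exact: (dihF F G (b, u)). Qed.

Let stepG i : link (false, rt i) (true, lf i).
Proof. by have := dihG F G (false, rt i); rewrite /G /mid_glue glue_rt eqxx. Qed.

Let stepG' i : link (true, lf i) (false, rt i).
Proof. by have := dihG F G (true, lf i); rewrite /G /mid_glue glue_lf eqxx. Qed.

Lemma compose_ll i j : f (lf i) = lf j -> compose f g (lf i) = lf j.
Proof.
move=> e; have h := stepF false (lf i); rewrite e in h.
case: (eqVneq (lf j) (lf i)) => [ji|/eqP ne]; last exact: pair_connect.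
rewrite ji; apply: pair_isolated => //; apply/existsP; exists (false, lf i).
by rewrite connect0 /pair_slot /diag_slot /= e ji eqxx.
Qed.

Lemma compose_rr1 i j : g (rt i) = rt j -> compose f g (rt i) = rt j.
Proof.
move=> e; have h := stepF true (rt i); rewrite e in h.
case: (eqVneq (rt j) (rt i)) => [ji|/eqP ne]; last exact: pair_connect.
rewrite ji; apply: pair_isolated => //; apply/existsP; exists (true, rt i).
by rewrite connect0 /pair_slot /diag_slot /= e ji eqxx.
Qed.

Lemma compose_lr i j k : f (lf i) = rt k -> g (lf k) = rt j -> compose f g (lf i) = rt j.
Proof.
move=> e1 e2; have h1 := stepF false (lf i); have h2 := stepF true (lf k).
rewrite e1 in h1; rewrite e2 in h2.
by apply: pair_connect => //; apply: connect_trans h1 (connect_trans (stepG k) h2).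
Qed.

Lemma compose_rl i j k : g (rt i) = lf k -> f (rt k) = lf j -> compose f g (rt i) = lf j.
Proof.
move=> e1 e2; have h1 := stepF true (rt i); have h2 := stepF false (rt k).
rewrite e1 in h1; rewrite e2 in h2.
by apply: pair_connect => //; apply: connect_trans h1 (connect_trans (stepG' k) h2).
Qed.

Lemma compose_rr i j k l : g (rt i) = lf k -> f (rt k) = rt l -> g (lf l) = rt j ->
  compose f g (rt i) = rt j.
Proof.
move=> e1 e2 e3; have h1 := stepF true (rt i); have h2 := stepF false (rt k).
have h3 := stepF true (lf l); rewrite e1 in h1; rewrite e2 in h2; rewrite e3 in h3.
have h12 := connect_trans h1 (stepG' k).
case: (eqVneq (rt j) (rt i)) => [ji|/eqP ne]; last first.
  apply: pair_connect => //; apply: connect_trans h12 _.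
  exact: connect_trans h2 (connect_trans (stepG l) h3).
(* If the path returns to its start, involutivity gives l = k, so f isolates row k and the component
   ends there. *)
have lk : l = k by apply: lf_inj; rewrite -[lf l]gK e3 ji e1.
rewrite ji; apply: pair_isolated => //; apply/existsP; exists (false, rt k).
by rewrite h12 /pair_slot /diag_slot /= e2 lk eqxx.
Qed.

End LocalProducts.

(* Rows in K carry the arcs of p in both columns, the other rows run straight across. *)
Definition arcs n (K : pred 'I_n) (p : 'I_n -> 'I_n) : {ffun vert n -> vert n} :=
  [ffun v => if K v.2 then (v.1, p v.2) else (if v.1 == ord0 then ord_max else ord0, v.2)].

(** * Right multiplication by an arc diagram *)

Section Arcs.
Variables (n : nat) (K : pred 'I_n) (p : 'I_n -> 'I_n).
Hypotheses (pK : involutive p) (Kp : forall i, K (p i) = K i).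

Lemma arcs_lf i : arcs K p (lf i) = if K i then lf (p i) else rt i.
Proof. by rewrite ffunE. Qed.

Lemma arcs_rt i : arcs K p (rt i) = if K i then rt (p i) else lf i.
Proof. by rewrite ffunE. Qed.

Lemma arcsK : involutive (arcs K p).
Proof.
elim/vertP => i; rewrite ?(arcs_lf, arcs_rt); case: (boolP (K i)) => Ki;
  rewrite ?(arcs_lf, arcs_rt) ?Kp ?Ki ?pK //= (negbTE Ki) //.
Qed.

Variable (f : {ffun vert n -> vert n}).
Hypotheses (fK : involutive f) (fp : forall i, K i -> f (rt i) = rt (p i)).

Lemma compose_arcs : compose f (arcs K p) = f.
Proof.
have nK a b : f (lf a) = rt b -> ~~ K b.
  by move=> e; apply/negP => /fp; rewrite -e fK.
have nK' a b : ~~ K a -> f (rt a) = rt b -> ~~ K b.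
  move=> Ka e; apply/negP => Kb; case/negP: Ka.
  have /rt_inj -> : rt a = rt (p b) by rewrite -fp // -e fK.
  by rewrite Kp.
apply/ffunP; elim/vertP => a.
  have [[b e]|[b e]] := vert_cases (f (lf a)); rewrite e.
    exact: (compose_ll fK arcsK e).
  by apply: (compose_lr fK arcsK e); rewrite arcs_lf (negbTE (nK _ _ e)).
case: (boolP (K a)) => Ka.
  by rewrite fp //; apply: (compose_rr1 fK arcsK); rewrite arcs_rt Ka.
have ea : arcs K p (rt a) = lf a by rewrite arcs_rt (negbTE Ka).
have [[b e]|[b e]] := vert_cases (f (rt a)); rewrite e.
  exact: (compose_rl fK arcsK ea e).
by apply: (compose_rr fK arcsK ea e); rewrite arcs_lf (negbTE (nK' _ _ Ka e)).
Qed.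

Let F := pair_slot f (arcs K p).
Let G := @mid_glue n.
Let GK : involutive G := glueK _ _.
Let FK : involutive F.
Proof. by apply: diag_slotK => -[] //; apply: arcsK. Qed.

(** The middle column in the rows of K, seen from both sides: right slots of f and left slots of the
    arc diagram. *)
Definition mid_slot (s : bool * vert n) := (s.1 == (s.2.1 == ord0)) && K s.2.2.

Let mid_slotF s : mid_slot s -> mid_slot (F s).
Proof.
case: s => -[]; elim/vertP => i; rewrite /mid_slot /F /pair_slot /diag_slot //= => Ki.
  by rewrite arcs_lf Ki /= Kp.
by rewrite fp //= Kp.
Qed.

Let mid_slotG s : mid_slot s -> mid_slot (G s).
Proof.
by case: s => -[]; elim/vertP => i //; rewrite /G /mid_glue ?(glue_lf, glue_rt).
Qed.

(** Rows of K stay enclosed in the middle, while any other middle row runs straight on to the right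
    outer column, which G fixes. *)
Lemma arcs_hasfixG s : hasfix F G G s = ~~ mid_slot s.
Proof.
apply/existsP/idP => [[t /andP [st /eqP Gt]]|].
  apply/negP => ms; have : mid_slot t.
    by apply: (dih_ind (A := mid_slot)) st.
  by case: t {st} Gt => -[]; elim/vertP => i; rewrite /G /mid_glue ?(glue_lf, glue_rt).
have out i : ~~ K i -> connect (dih F G) (true, lf i) (true, rt i).
  by move=> Ki; have := dihF F G (true, lf i); rewrite {2}/F /pair_slot /diag_slot /=
    arcs_lf (negbTE Ki).
case: s => -[]; elim/vertP => i; rewrite /mid_slot //= => Ki.
- exists (true, rt i); rewrite out // /G /mid_glue glue_rt; exact: eqxx.
- by exists (true, rt i); rewrite connect0 /G /mid_glue glue_rt eqxx.
- by exists (false, lf i); rewrite connect0 /G /mid_glue glue_lf eqxx.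
- exists (true, rt i); rewrite /G /mid_glue glue_rt eqxx andbT.
  apply: connect_trans (out _ Ki).
  by have := dihG F G (false, rt i); rewrite {2}/G /mid_glue glue_rt eqxx.
Qed.

Lemma count_arcs0 b : (forall i, ~~ K i) -> inner_count F G b = 0.
Proof.
move=> K0; rewrite /inner_count /n_comp_mem; apply: eq_card0 => s.
by rewrite /in_mem /= /inner_orbit /in_mem /= arcs_hasfixG /mid_slot (negbTE (K0 _)) !andbF.
Qed.

Lemma count_arcs1 b i : K i -> (forall k, K k -> k = i \/ k = p i) ->
  inner_count F G b = ((p i == i) == b).
Proof.
move=> Ki Kt.
have linkF k : K k -> connect (dih F G) (false, rt i) (false, rt k).
  move=> Kk; case: (Kt _ Kk) => ->; first exact: connect0.
  by rewrite -fp //; exact: (dihF F G (false, rt i)).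
have linkG k : connect (dih F G) (false, rt k) (true, lf k).
  by have := dihG F G (false, rt k); rewrite {2}/G /mid_glue glue_rt eqxx.
have orb s : connect (dih F G) (false, rt i) s = mid_slot s.
  apply/idP/idP => [st|].
    by apply: (dih_ind (A := mid_slot)) st => //; rewrite /mid_slot /= Ki.
  case: s => -[]; elim/vertP => k //; rewrite /mid_slot /= => Kk.
    exact: connect_trans (linkF _ Kk) (linkG _).
  exact: linkF.
have hF s : mid_slot s -> hasfix F G F s = (p i == i).
  rewrite -orb => st; rewrite -(hasfix_closed FK GK _ st).
  apply/existsP/eqP => [[t /andP []]|pi]; last first.
    by exists (false, rt i); rewrite connect0 /F /pair_slot /diag_slot /= fp // pi eqxx.
  rewrite orb; case: t => -[]; elim/vertP => k; rewrite /mid_slot //= => Kk /eqP [];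
    rewrite ?arcs_lf ?Kk ?fp //.
    by move/lf_inj; case: (Kt _ Kk) => -> //; rewrite pK.
  by move/rt_inj; case: (Kt _ Kk) => -> //; rewrite pK.
have inner s : inner_orbit F G b s = ((p i == i) == b) && mid_slot s.
  rewrite /inner_orbit /= arcs_hasfixG negbK; case: (boolP (mid_slot s)) => [/hF ->|] //.
  by rewrite !andbF.
rewrite /inner_count; case: eqP => e.
  rewrite -[RHS](n_comp_connect (dih_sym FK GK) (false, rt i)); apply: eq_n_comp_r => s.
  by rewrite /in_mem /= inner e eqxx -orb.
rewrite /n_comp_mem; apply: eq_card0 => s; rewrite /in_mem /= /in_mem /= inner.
by move/eqP/negbTE: e => ->; rewrite andbF.
Qed.

Lemma arcs_comps0 : (forall i, ~~ K i) ->
  comp_alpha f (arcs K p) = 0 /\ comp_beta f (arcs K p) = 0.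
Proof.
move=> K0; have H := pair_gluing fK arcsK.
by rewrite (comp_alpha_count H) (comp_beta_count H) -/F -/G !count_arcs0.
Qed.

Lemma arcs_comps1 i : K i -> (forall k, K k -> k = i \/ k = p i) ->
  comp_alpha f (arcs K p) = (p i != i) /\ comp_beta f (arcs K p) = (p i == i).
Proof.
move=> Ki Kt; have H := pair_gluing fK arcsK.
rewrite (comp_alpha_count H) (comp_beta_count H) -/F -/G !(count_arcs1 _ Ki Kt).
by case: (p i == i).
Qed.

End Arcs.

(** * The monoid of Motzkin diagrams and its corners *)

Section Motzkin.
Variable n : nat.
Implicit Types x y z : MD n.

Lemma MD_involutive x : involutive (val x).
Proof. by case: x => f /= /andP [/forallP h _] u; apply/eqP. Qed.

Lemma MD_planar x : planar (val x).
Proof. by case: x => f /= /andP []. Qed.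

Lemma motzkin_intro (f : {ffun vert n -> vert n}) : involutive f -> planar f -> motzkin f.
Proof. by move=> fK fP; rewrite /motzkin fP andbT; apply/forallP => u; rewrite fK. Qed.

Lemma compose_motzkin x y : motzkin (compose (val x) (val y)).
Proof.
have [fK gK] := (MD_involutive x, MD_involutive y).
apply: motzkin_intro; first exact: pair_composeK.
exact: compose_planar (MD_planar x) (MD_planar y).
Qed.

Definition mmul x y : MD n := Sub (compose (val x) (val y)) (compose_motzkin x y).

Lemma mmulA : associative mmul.
Proof. by move=> x y z; apply: val_inj => /=; apply: composeA; apply: MD_involutive. Qed.

Lemma straight_motzkin : motzkin (arcs (fun _ : 'I_n => false) id).
Proof.
apply: motzkin_intro; first exact: arcsK.
apply/forallP => u; apply/forallP => v; apply/implyP => _.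
elim/vertP: u => i; elim/vertP: v => j; rewrite ?arcs_lf ?arcs_rt !bpos_lf !bpos_rt /chords_cross;
  have := ltn_ord i; have := ltn_ord j; lia.
Qed.

Definition mone : MD n := Sub _ straight_motzkin.

Lemma mmul1 x : mmul x mone = x.
Proof. by apply: val_inj; apply: compose_arcs => //; apply: MD_involutive. Qed.

(* A corner (i, j) with j = i stands for an isolated row, with j = i + 1 for an arc
   joining two adjacent rows. *)
Definition corner (s : 'I_n * 'I_n) : bool := (s.1 == s.2) || (s.2 == s.1.+1 :> nat).

Definition has_corner (s : 'I_n * 'I_n) x : bool := val x (rt s.1) == rt s.2.

Let K (s : 'I_n * 'I_n) : pred 'I_n := pred2 s.1 s.2.
Let p (s : 'I_n * 'I_n) := tperm s.1 s.2.
Let pK s : involutive (p s). Proof. exact: tpermK. Qed.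
Let Kp s i : K s (p s i) = K s i.
Proof. by rewrite /K /p /=; case: tpermP => [->|->|//]; rewrite !eqxx ?orbT. Qed.

Let hasP s x : has_corner s x -> forall i, K s i -> val x (rt i) = rt (p s i).
Proof.
move=> /eqP h i /orP [] /eqP ->; rewrite /p ?tpermL ?tpermR //.
by rewrite -h MD_involutive.
Qed.

Lemma corner_motzkin s : corner s -> motzkin (arcs (K s) (p s)).
Proof.
case: s => a b; rewrite /corner /= => ab.
apply: motzkin_intro; first exact: (arcsK (@pK _) (@Kp _)).
have {}ab : (a = b :> nat) \/ (b = a.+1 :> nat).
  by case/orP: ab => /eqP; [move=> ->; left|right].
have la := ltn_ord a; have lb := ltn_ord b.
have pE i : K (a, b) i -> (i = a :> nat /\ p (a, b) i = b :> nat) \/ (i = b :> nat /\ p (a, b) i = a :> nat).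
  by case/orP => /eqP ->; rewrite /p /= ?tpermL ?tpermR; auto.
have nE i : ~~ K (a, b) i -> i <> a :> nat /\ i <> b :> nat.
  by rewrite /K /= negb_or => /andP [/eqP h1 /eqP h2]; split=> /val_inj.
apply/forallP => u; apply/forallP => v; apply/implyP => _.
elim/vertP: u => i; elim/vertP: v => j; rewrite ?arcs_lf ?arcs_rt;
  have li := ltn_ord i; have lj := ltn_ord j;
  case: (boolP (K (a, b) i)) => [/pE|/nE]; case: (boolP (K (a, b) j)) => [/pE|/nE];
  move: (p (a, b) i) (p (a, b) j) => i' j';
  rewrite ?bpos_lf ?bpos_rt /chords_cross; lia.
Qed.

Definition corner_gen s (h : corner s) : MD n := Sub _ (corner_motzkin h).

Lemma has_corner_gen s (h : corner s) : has_corner s (corner_gen h).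
Proof. by apply/eqP; rewrite /= arcs_rt /K /= eqxx /= /p tpermL. Qed.

Lemma mmul_corner s (h : corner s) x : has_corner s x -> mmul x (corner_gen h) = x.
Proof.
move=> xs; apply: val_inj; apply: compose_arcs; [exact: pK|exact: Kp|exact: MD_involutive|].
exact: hasP.
Qed.

Lemma has_corner_mmul s x y : has_corner s y -> has_corner s (mmul x y).
Proof. by move=> /eqP h; apply/eqP; apply: compose_rr1 => //; apply: MD_involutive. Qed.

(** The diagram z witnesses compatibility: a row shared by s and t would have the same partner for
    both, forcing s = t. With disjoint rows, the generator of t runs straight across the rows of
    s. *)
Lemma has_corner_disjoint s t (h : corner t) z x :
  corner s -> s <> t -> has_corner s z -> has_corner t z ->
  has_corner s x -> has_corner s (mmul x (corner_gen h)).
Proof.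
move=> hs st zs zt xs.
have sub i : K t i -> ~~ K s i.
  move=> Kt; apply/negP => Ks; apply: st.
  have e : p t i = p s i by apply: rt_inj; rewrite -(hasP zs Ks) -(hasP zt Kt).
  move: hs h Ks Kt e; case: s {zs xs} => a b; case: t {zt} => c d.
  rewrite /corner /K /p /= => ab cd /orP [] /eqP -> /orP [] /eqP;
    rewrite ?tpermL ?tpermR => ic; try subst c; try subst d; rewrite ?tpermL ?tpermR => h';
    try subst; rewrite -?val_eqE /= in ab cd *; try (congr pair; apply: val_inj => /=); try lia.
have nK i : K s i -> ~~ K t i by move=> Ks; apply/negP => /sub; rewrite Ks.
have K1 : K s s.1 by rewrite /K /= eqxx.
have K2 : K s s.2 by rewrite /K /= eqxx orbT.
apply/eqP; have tK := MD_involutive (corner_gen h).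
apply: (compose_rr (MD_involutive x) tK (k := s.1) (l := s.2)).
- by rewrite /= arcs_rt (negbTE (nK _ K1)).
- exact/eqP.
- by rewrite /= arcs_lf (negbTE (nK _ K2)).
Qed.

Lemma corner_comps s (h : corner s) x : has_corner s x ->
  comp_alpha (val x) (val (corner_gen h)) = (s.2 != s.1) /\
  comp_beta (val x) (val (corner_gen h)) = (s.2 == s.1).
Proof.
move=> xs; have p1 : p s s.1 = s.2 by exact: tpermL.
rewrite -p1; apply: (arcs_comps1 (@pK s) (@Kp s) (MD_involutive x) (hasP xs)).
  by rewrite /K /= eqxx.
by move=> k /orP [] /eqP ->; rewrite ?p1; auto.
Qed.

Lemma mone_comps x : comp_alpha (val x) (val mone) = 0 /\ comp_beta (val x) (val mone) = 0.
Proof. by apply: arcs_comps0 => //; apply: MD_involutive. Qed.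

Lemma mone_no_corner s : ~~ has_corner s mone.
Proof. by rewrite /has_corner /= arcs_rt. Qed.

(** An innermost arc on the right, or an isolated row, is a corner. If the right column has neither,
    all its vertices propagate, and planarity makes the matching increasing, hence the identity. *)
Lemma corner_cover x : x <> mone -> exists2 s, corner s & has_corner s x.
Proof.
move=> x1; have xK := MD_involutive x.
have nc u v : val x u != u -> val x v != v ->
    ~~ chords_cross (bpos u) (bpos (val x u)) (bpos v) (bpos (val x v)).
  by move=> hu hv; have /forallP/(_ u)/forallP/(_ v) := MD_planar x; rewrite hu hv.
(* Induction on the width: row i + 1 is enclosed by the arc, so it cannot reach the left column; it
   is isolated or starts a strictly narrower arc inside. *)
have arc m : forall i j : 'I_n, i <= j -> j - i <= m -> val x (rt i) = rt j ->
    exists2 s, corner s & has_corner s x.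
  elim: m => [|m IH] i j ij jm e.
    exists (i, j); rewrite /corner /has_corner /= ?e //; apply/orP; left; apply/eqP/val_inj => /=; lia.
  case: (ltnP i.+1 j) => [ij2|ji]; last first.
    exists (i, j); rewrite /corner /has_corner /= ?e // -val_eqE /=; lia.
  have lk : i.+1 < n := ltn_trans ij2 (ltn_ord j).
  pose k := Ordinal lk.
  have li := ltn_ord i; have lj := ltn_ord j.
  have ni : val x (rt i) != rt i by rewrite e; apply/eqP => /rt_inj ji; rewrite ji /= in ij2; lia.
  have [[a ea]|[l el]] := vert_cases (val x (rt k)).
    have nk : val x (rt k) != rt k by rewrite ea.
    have := nc _ _ nk ni; rewrite ea e !bpos_lf !bpos_rt /chords_cross /=.
    have := ltn_ord a; lia.
  case: (eqVneq l k) => [lk'|nlk].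
    by exists (k, k); rewrite /corner /has_corner /= ?eqxx // el lk'.
  have nk : val x (rt k) != rt k by rewrite el; apply: contraNneq nlk => /rt_inj ->.
  have nli : l <> i.
    move=> li'; move: (xK (rt k)); rewrite el li' e => /rt_inj jk.
    by rewrite jk /= in ij2; lia.
  have nlj : l <> j.
    move=> lj'; move: (xK (rt k)); rewrite el lj' -e xK => /rt_inj /(congr1 val) /=; lia.
  have v1 : val l <> val i by move/val_inj.
  have v2 : val l <> val j by move/val_inj.
  have v3 : val l <> i.+1 by move=> h; case/eqP: nlk; apply: val_inj.
  have ll := ltn_ord l.
  have c1 := nc _ _ nk ni; have c2 := nc _ _ ni nk.
  move: c1 c2; rewrite el e !bpos_rt /chords_cross /= => c1 c2.
  by apply: (IH k l _ _ el) => /=; rewrite /= in v1 v2 v3 *; lia.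
case: (boolP [exists i, exists j, val x (rt i) == rt j]).
  case/existsP => i /existsP [j /eqP e]; case: (leqP i j) => ij.
    exact: (arc (j - i) i j).
  apply: (arc (i - j) j i) => //; first exact: ltnW.
  by rewrite -e xK.
move=> /existsPn na; case: x1.
have [q qE] : exists q : 'I_n -> 'I_n, forall i, val x (rt i) = lf (q i).
  exists (fun i => (val x (rt i)).2) => i.
  have [[a e]|[a e]] := vert_cases (val x (rt i)); first by rewrite e.
  by case/existsPn/(_ a)/eqP: (na i).
have q_inj : injective q.
  by move=> i j e; apply: rt_inj; rewrite -[rt i]xK -[rt j]xK !qE e.
have q_mono (i j : 'I_n) : i < j -> q i < q j.
  move=> ij.
  have n1 : val x (rt i) != rt i by rewrite qE.
  have n2 : val x (rt j) != rt j by rewrite qE.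
  have := nc _ _ n2 n1; rewrite !qE !bpos_lf !bpos_rt /chords_cross.
  have : val (q i) <> val (q j) by move/val_inj/q_inj => e; rewrite e ltnn in ij.
  have := ltn_ord i; have := ltn_ord j; have := ltn_ord (q i); have := ltn_ord (q j) => /=; lia.
have q_ge m : forall i : 'I_n, i = m :> nat -> i <= q i.
  elim: m => [|m IH] i im; first by rewrite im.
  have lm : m < n by rewrite -ltnS -im; apply: leqW; exact: ltn_ord.
  have := q_mono (Ordinal lm) i; have := IH (Ordinal lm) erefl; rewrite /= im; lia.
have q_le m : forall i : 'I_n, n - i.+1 = m :> nat -> q i <= i.
  elim: m => [|m IH] i im; first by have := ltn_ord (q i); lia.
  have lm : i.+1 < n by lia.
  have := q_mono i (Ordinal lm); have := IH (Ordinal lm); rewrite /=; lia.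
have q1 i : q i = i.
  apply: val_inj; apply/eqP; rewrite eqn_leq (q_le _ _ erefl) (q_ge _ _ erefl) //.
apply: val_inj; apply/ffunP; elim/vertP => i; rewrite /= ?arcs_lf ?arcs_rt.
  by rewrite -{1}[i]q1 -qE xK.
by rewrite qE q1.
Qed.

(** By injectivity n propagating edges use up the right column, which leaves no room for a
    corner. *)
Lemma nprop_mone x : (nprop (val x) == n) = (x == mone).
Proof.
apply/eqP/eqP => [e|->]; last first.
  rewrite /nprop -[RHS]card_ord -cardsT; congr #|pred_of_set _|.
  by apply/setP => i; rewrite !inE /= arcs_lf.
case: (eqVneq x mone) => // /eqP /corner_cover [s _ /eqP h].
have all_r i : exists j, val x (lf i) = rt j.
  have [[j ej]|//] := vert_cases (val x (lf i)).
  suff : i \in [set i | ((val x (ord0, i)).1 : nat) == 1] by rewrite inE [val x _]ej.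
  suff -> : [set i | ((val x (ord0, i)).1 : nat) == 1] = [set: 'I_n] by rewrite inE.
  by apply/eqP; rewrite eqEcard subsetT cardsT card_ord; apply: eq_leq (esym e).
pose r i := (val x (lf i)).2.
have rE i : val x (lf i) = rt (r i) by have [j ej] := all_r i; rewrite /r ej.
have r_inj : injective r.
  by move=> i j ij; apply: lf_inj; rewrite -[lf i](MD_involutive x) -[lf j](MD_involutive x) !rE ij.
have [r' _ r'K] := injF_bij r_inj.
by move: h; rewrite -[s.1]r'K -rE MD_involutive.
Qed.

(** Corners of the right factor survive in the product, so x y = 1 forces y = 1 and then x = 1. *)
Lemma mmul_eq1 x y : (mmul x y == mone) = (x == mone) && (y == mone).
Proof.
apply/eqP/andP => [e|[/eqP -> /eqP ->]]; last by rewrite mmul1.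
have ey : y == mone.
  case: (eqVneq y mone) => // /eqP /corner_cover [s _ /(has_corner_mmul x)].
  by rewrite e (negbTE (mone_no_corner s)).
by move: e; rewrite (eqP ey) mmul1 => ->.
Qed.

End Motzkin.

(** * Bar complex of a twisted monoid algebra *)

Local Open Scope ring_scope.

Section TwistedBar.
Variables (k : comPzRingType) (T : eqType) (mul : T -> T -> T) (c : T -> T -> k) (one : T).
Hypothesis mulA : associative mul.
Hypothesis cA : forall x y z, c x y * c (mul x y) z = c y z * c x (mul y z).
Hypotheses (mul1 : forall x, mul x one = x) (c1 : forall x, c x one = 1).
Hypothesis mul_eq1 : forall x y, (mul x y == one) = (x == one) && (y == one).

Implicit Types (phi psi : seq T -> k) (w u v : seq T) (J : pred T).

Definition aug (x : T) : k := if x == one then 1 else 0.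

(** The alternating sum of the faces merging neighbours. As phi is evaluated on the faces, operators
    on such functions are transposes of maps of chains. *)
Fixpoint merges phi (a : T) w : k :=
  if w is b :: w' then c a b * phi (mul a b :: w') - merges (fun u => phi (a :: u)) b w'
  else 0.

(* The bar differential without its last face, acting on functions of words; it is the
   full differential on words ending outside the unit. *)
Definition bdiff phi w : k := if w is a :: w' then aug a * phi w' - merges phi a w' else 0.

Definition ends_in J w : bool := if w is a :: w' then J (last a w') else false.

(** Excluding the unit makes [aug] kill the face from a one-letter word to the empty word, the only
    face in [bdiff] that would leave the words ending in J. *)
Definition left_ideal J := (forall x y, J y -> J (mul x y)) /\ ~~ J one.

Lemma ends_in_cons J a w : ends_in J w -> ends_in J (a :: w).
Proof. by case: w. Qed.

Lemma ends_in_rcons J w x : ends_in J (rcons w x) = J x.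
Proof. by case: w => //= a w; rewrite last_rcons. Qed.

Lemma merges_local J phi psi a w : (forall x y, J y -> J (mul x y)) -> ends_in J (a :: w) ->
  (forall u, size u = size w -> ends_in J u -> phi u = psi u) ->
  merges phi a w = merges psi a w.
Proof.
move=> JL; elim: w a phi psi => //= b w IH a phi psi Jw e; rewrite e //=; last first.
  by case: w Jw {IH e} => //= ; apply: JL.
by congr (_ - _); apply: IH => // u su Ju; apply: e; [rewrite /= su | exact: ends_in_cons].
Qed.

Lemma bdiff_local J phi psi w : left_ideal J -> ends_in J w ->
  (forall u, (size u).+1 = size w -> ends_in J u -> phi u = psi u) ->
  bdiff phi w = bdiff psi w.
Proof.
case=> JL J1; case: w => // a w Jw e; rewrite /bdiff.
congr (_ - _); last by apply: (merges_local JL Jw) => u su Ju; rewrite e //= su.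
case: w Jw e => [|b w] Jw e; last by rewrite e.
rewrite /aug; case: eqP => [ea|_]; last by rewrite !mul0r.
by move: Jw; rewrite /= ea (negbTE J1).
Qed.

Lemma merges_lin r phi psi a w :
  merges (fun u => r * phi u + psi u) a w = r * merges phi a w + merges psi a w.
Proof. by elim: w a phi psi => [|b w IH] a phi psi /=; [ring | rewrite IH; ring]. Qed.

Lemma merges0 a w : merges (fun=> 0) a w = 0.
Proof. by elim: w a => //= b w IH a; rewrite IH; ring. Qed.

Lemma eq_merges phi psi a w : phi =1 psi -> merges phi a w = merges psi a w.
Proof. by move=> e; apply: (@merges_local predT). Qed.

Lemma merges_linB r phi psi a w :
  merges (fun u => r * phi u - psi u) a w = r * merges phi a w - merges psi a w.
Proof.
rewrite merges_lin; congr (_ + _); rewrite -mulN1r -[RHS]addr0 -(merges0 a w) -merges_lin.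
by apply: eq_merges => u; ring.
Qed.

Lemma bdiff_lin r phi psi w :
  bdiff (fun u => r * phi u + psi u) w = r * bdiff phi w + bdiff psi w.
Proof. by case: w => [|a w] /=; [ring | rewrite merges_lin; ring]. Qed.

Lemma bdiffZ r phi w : bdiff (fun u => r * phi u) w = r * bdiff phi w.
Proof.
have z : bdiff (fun=> 0) w = 0 by case: w => //= a w; rewrite merges0; ring.
rewrite -[RHS]addr0 -z -bdiff_lin; case: w {z} => //= a w; congr (_ * _ - _); first by ring.
by apply: eq_merges => u; ring.
Qed.

Lemma bdiffB phi psi w : bdiff (fun u => phi u - psi u) w = bdiff phi w - bdiff psi w.
Proof.
have := bdiff_lin (-1) psi phi w; rewrite mulN1r addrC => <-.
case: w => //= a w; congr (_ * _ - _); first by ring.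
by apply: eq_merges => u; ring.
Qed.

Lemma bdiffD phi psi w : bdiff (fun u => phi u + psi u) w = bdiff phi w + bdiff psi w.
Proof.
have := bdiff_lin 1 phi psi w; rewrite mul1r => <-.
case: w => //= a w; congr (_ * _ - _); first by ring.
by apply: eq_merges => u; ring.
Qed.

Lemma merges_rcons phi a w e :
  merges phi a (rcons w e) = merges (fun u => phi (rcons u e)) a w
    + (-1) ^+ size w * (c (last a w) e * phi (rcons (belast a w) (mul (last a w) e))).
Proof.
elim: w a phi => [|b w IH] a phi /=; first by rewrite expr0; ring.
by rewrite IH exprS; ring.
Qed.

Lemma bdiff_rcons phi v x e :
  bdiff phi (rcons (rcons v x) e) = bdiff (fun u => phi (rcons u e)) (rcons v x)
    - (-1) ^+ size v * (c x e * phi (rcons v (mul x e))).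
Proof.
have -> : rcons v x = head x v :: behead (rcons v x) by case: v.
rewrite rcons_cons /= merges_rcons.
have -> : size (behead (rcons v x)) = size v by rewrite size_behead size_rcons.
have -> : last (head x v) (behead (rcons v x)) = x by case: v => //= a v; rewrite last_rcons.
have -> : belast (head x v) (behead (rcons v x)) = v by case: v => //= a v; rewrite belast_rcons.
by ring.
Qed.

(** This says that [merges] applied twice gives zero. In the induction the two ways of merging three
    letters agree by [cA] and [mulA]. *)
Lemma merges_merge phi a b w :
  c a b * merges phi (mul a b) w = merges (fun u => merges phi a u) b w.
Proof.
elim: w a b phi => [|d w IH] a b phi /=; first by ring.
rewrite merges_linB -IH mulrBr mulrA cA -mulA; ring.
Qed.

Lemma aug_mul a b : c a b * aug (mul a b) = aug a * aug b.
Proof.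
rewrite /aug mul_eq1; case: eqP => [->|_] /=; last by ring.
by case: eqP => [->|_]; rewrite ?c1; ring.
Qed.

Lemma bdiff_bdiff phi w : bdiff (bdiff phi) w = 0.
Proof.
case: w => [|a [|b w]] //=; first by ring.
rewrite merges_linB -merges_merge.
have := aug_mul a b; set t := aug (mul a b); move=> e.
transitivity ((aug a * aug b - c a b * t) * phi w); first by ring.
by rewrite e; ring.
Qed.

(** Locality makes H a matrix in each length; it also serves as extensionality, since functions with
    equal values need not be equal terms. *)
Definition contraction J (H : (seq T -> k) -> seq T -> k) : Prop :=
  [/\ (forall r phi psi w, ends_in J w ->
         H (fun u => r * phi u + psi u) w = r * H phi w + H psi w),
      (forall phi psi w, ends_in J w ->
         (forall u, size u = (size w).+1 -> ends_in J u -> phi u = psi u) ->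
         H phi w = H psi w) &
      (forall phi w, ends_in J w -> bdiff (H phi) w + H (bdiff phi) w = phi w)].

Definition contractible J := exists H, contraction J H.

Lemma eq_contractible J J' : J =1 J' -> contractible J -> contractible J'.
Proof.
move=> e [H [H1 H2 H3]]; exists H.
have ee w : ends_in J' w = ends_in J w by case: w => //= a w; rewrite e.
split=> [r phi psi w|phi psi w|phi w]; rewrite ee.
- exact: H1.
- by move=> Jw h; apply: H2 => // u su Ju; apply: h => //; rewrite ee.
- exact: H3.
Qed.

Lemma contractible0 J : J =1 pred0 -> contractible J.
Proof.
move=> J0; exists (fun _ _ => 0); split=> [? ? ? w|? ? w|? w];
  by case: w => //= a w; rewrite J0.
Qed.

Lemma contractible_principal J e lam : left_ideal J -> J e ->
  (forall x, J x -> mul x e = x /\ lam * c x e = 1) -> contractible J.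
Proof.
move=> JL Je Jx; exists (fun phi w => (-1) ^+ size w * (lam * phi (rcons w e))).
split=> [r phi psi w _|phi psi w _ h|phi w]; first by ring.
  by rewrite h ?size_rcons // ends_in_rcons.
case/lastP: w => // v x; rewrite ends_in_rcons => Jx'; have [xe lx] := Jx x Jx'.
rewrite bdiff_rcons xe size_rcons.
have -> : bdiff (fun u => (-1) ^+ size u * (lam * phi (rcons u e))) (rcons v x) =
    (-1) ^+ size v * lam * bdiff (fun u => phi (rcons u e)) (rcons v x).
  rewrite -bdiffZ; apply: (bdiff_local JL); first by rewrite ends_in_rcons.
  by move=> u; rewrite size_rcons => -[->] _; ring.
(* All terms cancel except the face merging e into x. *)
transitivity ((-1) ^+ size v * (-1) ^+ size v * (lam * c x e) * phi (rcons v x)).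
  by rewrite exprS; ring.
have ss : (-1) ^+ size v * (-1) ^+ size v = 1 :> k by rewrite -exprMn mulrNN mulr1 expr1n.
by rewrite lx ss; ring.
Qed.

Lemma contraction0 J H w : contraction J H -> ends_in J w -> H (fun=> 0) w = 0.
Proof.
case=> lin loc _ Jw; have e : H (fun=> 0) w = H (fun=> -1 * 0 + 0) w.
  by apply: loc => // u _ _; rewrite mulr0 addr0.
by rewrite e (lin (-1) (fun=> 0) (fun=> 0)) // mulN1r addNr.
Qed.

Lemma contractionN J H phi w : contraction J H -> ends_in J w ->
  H (fun u => - phi u) w = - H phi w.
Proof.
move=> cH Jw; have [lin loc _] := cH.
have := lin (-1) phi (fun=> 0) w Jw; rewrite (contraction0 cH Jw) addr0 [RHS]mulN1r => <-.
by apply: loc => // u _ _; ring.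
Qed.

(** * Mayer-Vietoris for two left ideals *)

Section MayerVietoris.
Variables (J1 J2 : pred T) (H1 H2 H12 : (seq T -> k) -> seq T -> k).
Hypotheses (J1L : left_ideal J1) (J2L : left_ideal J2).
Hypotheses (C1 : contraction J1 H1) (C2 : contraction J2 H2).
Hypothesis C12 : contraction (predI J1 J2) H12.

Let J12L : left_ideal (predI J1 J2).
Proof.
case: J1L J2L => L1 n1 [L2 n2]; split=> [x y /andP [h1 h2]|]; rewrite /= ?(negbTE n1) //.
by rewrite L1 // L2.
Qed.

Let ends_in12 w : ends_in (predI J1 J2) w = ends_in J1 w && ends_in J2 w.
Proof. by case: w. Qed.

(** A word ending in J2 but not in J1 may have a face ending in J1, while [glue_h] is under control
    only on the intersection; among words of J2, extension by zero off J1 bridges the two. *)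
Let restr psi w := if ends_in J1 w then psi w else 0.
Let diff phi w := H2 phi w - H1 phi w.
Let glue_h phi := H12 (diff phi).

(* H1 on J1 and H2 elsewhere, corrected by the null homotopy glue_h of H2 - H1 on the
   intersection. *)
Let H phi w :=
  if ends_in J1 w then H1 phi w else H2 phi w - bdiff (restr (glue_h phi)) w.

(** H2 - H1 anticommutes with the differential on the intersection, so the homotopy identity for H12
    makes the formula return H1 there. On J2 the operator H thus differs from H2 by a commutator
    with [bdiff], which leaves the homotopy identity intact. *)
Let H_on2 phi w : ends_in J2 w ->
  H phi w = H2 phi w - bdiff (restr (glue_h phi)) w + restr (glue_h (bdiff phi)) w.
Proof.
move=> w2; rewrite /H /restr; case: (boolP (ends_in J1 w)) => w1; last by rewrite addr0.
have w12 : ends_in (predI J1 J2) w by rewrite ends_in12 w1.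
have [_ loc12 hom12] := C12; have [_ _ hom1] := C1; have [_ _ hom2] := C2.
rewrite -/(restr (glue_h phi)) (_ : bdiff (restr _) w = bdiff (glue_h phi) w); last first.
  by apply: (bdiff_local J12L w12) => u _; rewrite ends_in12 /restr => /andP [-> _].
have e : H12 (bdiff (diff phi)) w = - glue_h (bdiff phi) w.
  rewrite /glue_h -(contractionN _ C12 w12); apply: loc12 => // u _.
  rewrite ends_in12 => /andP [u1 u2]; rewrite /diff bdiffB.
  transitivity ((bdiff (H2 phi) u + H2 (bdiff phi) u) - (bdiff (H1 phi) u + H1 (bdiff phi) u)
    - (H2 (bdiff phi) u - H1 (bdiff phi) u)); first by ring.
  by rewrite hom1 // hom2 //; ring.
have := hom12 (diff phi) w w12; rewrite e -/(glue_h phi) /diff => e'.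
have -> : bdiff (glue_h phi) w = H2 phi w - H1 phi w + glue_h (bdiff phi) w.
  by rewrite -e'; ring.
by ring.
Qed.

Let restr_glue_lin r phi psi w : ends_in J2 w ->
  restr (glue_h (fun u => r * phi u + psi u)) w =
  r * restr (glue_h phi) w + restr (glue_h psi) w.
Proof.
move=> w2; rewrite /restr; case: (boolP (ends_in J1 w)) => w1; last by ring.
have w12 : ends_in (predI J1 J2) w by rewrite ends_in12 w1.
have [lin12 loc12 _] := C12; have [lin1 _ _] := C1; have [lin2 _ _] := C2.
rewrite /glue_h -lin12 //; apply: loc12 => // u _; rewrite ends_in12 => /andP [u1 u2].
by rewrite /diff lin1 // lin2 //; ring.
Qed.

Let ends_inU w : ends_in (predU J1 J2) w = ends_in J1 w || ends_in J2 w.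
Proof. by case: w. Qed.

Lemma contractible_union : contractible (predU J1 J2).
Proof.
have [lin1 loc1 hom1] := C1; have [lin2 loc2 hom2] := C2; have [lin12 loc12 hom12] := C12.
exists H; split=> [r phi psi w|phi psi w|phi w]; rewrite ends_inU.
- rewrite /H; case: (boolP (ends_in J1 w)) => [w1 _|_ w2]; first exact: lin1.
  rewrite lin2 // (_ : bdiff (restr (glue_h _)) w =
    r * bdiff (restr (glue_h phi)) w + bdiff (restr (glue_h psi)) w); first by ring.
  by rewrite -bdiff_lin; apply: (bdiff_local J2L w2) => u _ u2; apply: restr_glue_lin.
- rewrite /H => wU h; case: (boolP (ends_in J1 w)) => w1.
    by apply: loc1 => // u su u1; apply: h => //; rewrite ends_inU u1.
  have w2 : ends_in J2 w by rewrite (negbTE w1) in wU.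
  congr (_ - _).
    by apply: loc2 => // u su u2; apply: h => //; rewrite ends_inU u2 orbT.
  apply: (bdiff_local J2L w2) => u su u2; rewrite /restr; case: ifP => // u1.
  apply: loc12 => [|v sv]; rewrite ends_in12 ?u1 // => /andP [v1 v2].
  rewrite /diff (loc1 phi psi) ?(loc2 phi psi) // => y sy y1; apply: h; rewrite ?ends_inU ?y1 ?orbT //;
    by rewrite sy sv su.
- move=> wU; case: (boolP (ends_in J1 w)) => w1.
    rewrite -[RHS](hom1 phi w w1) {2}/H w1; congr (_ + _).
    by apply: (bdiff_local J1L w1) => u _ u1; rewrite /H u1.
  have w2 : ends_in J2 w by rewrite (negbTE w1) in wU.
  rewrite (_ : bdiff (H phi) w = bdiff (fun u => H2 phi u - bdiff (restr (glue_h phi)) u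
      + restr (glue_h (bdiff phi)) u) w); last first.
    by apply: (bdiff_local J2L w2) => u _ u2; apply: H_on2.
  rewrite bdiffD bdiffB bdiff_bdiff {1}/H (negbTE w1) -[RHS](hom2 phi w w2); ring.
Qed.

End MayerVietoris.

(** * Finite unions of left ideals *)

Section Cover.
Variables (I : eqType) (P : I -> pred T).
Hypothesis PL : forall s, left_ideal (P s).

Definition meet (S : seq I) : pred T := fun x => all (fun s => P s x) S.

Hypothesis meet_contractible : forall s S, contractible (meet (s :: S)).

(** Lists of lists make the induction close: intersecting a union of |L| meets with one more meet is
    again a union of |L| meets, obtained by concatenation. *)
Lemma contractible_cover (L : seq (seq I)) : all (fun S => 0 < size S)%N L ->
  contractible (fun x => has (fun S => meet S x) L).
Proof.
have meetM S x y : meet S y -> meet S (mul x y).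
  elim: S => //= s S IH /andP [h1 h2]; rewrite IH // andbT.
  by have [h _] := PL s; apply: h.
have meetL S : (0 < size S)%N -> left_ideal (meet S).
  by case: S => // s S _; split=> [x y|/=]; [exact: meetM | have [_ /negbTE ->] := PL s].
have [m] := ubnP (size L); elim: m L => // m IH [_ _|S L]; first exact: contractible0.
rewrite ltnS /= => Lm /andP [S0 L0].
have [H1 C1] := IH L Lm L0.
have [H2 C2] : contractible (meet S) by case: S S0.
have [H12 C12] : contractible (fun x => has (fun S' => meet S' x) [seq S ++ S' | S' <- L]).
  apply: IH; rewrite ?size_map // all_map; apply/allP => S' /=.
  by move=> _; rewrite size_cat addn_gt0 S0.
have LL : left_ideal (fun x => has (fun S' => meet S' x) L).
  split=> [x y /hasP [S' S'L h]|]; first by apply/hasP; exists S' => //; apply: meetM.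
  by apply/hasPn => S' /(allP L0) /meetL [].
have e : (fun x => has (fun S' => meet S' x) [seq S ++ S' | S' <- L]) =1
    predI (fun x => has (fun S' => meet S' x) L) (meet S).
  move=> x; rewrite has_map /= andbC; elim: (L) => [|S' L' h] /=; first by rewrite andbF.
  by rewrite h andb_orr {1}/meet all_cat.
have [H12' C12'] := eq_contractible e (ex_intro _ H12 C12).
apply: eq_contractible (contractible_union LL (meetL S S0) C1 C2 C12') => x.
by rewrite /= orbC.
Qed.

End Cover.

(** * The full bar complex *)

Definition bar_full phi w : k :=
  if w is a :: w' then bdiff phi w + (-1) ^+ size w * (aug (last a w') * phi (belast a w'))
  else 0.

Lemma bar_full_rcons phi v x :
  bar_full phi (rcons v x) = bdiff phi (rcons v x) - (-1) ^+ size v * (aug x * phi v).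
Proof.
rewrite /bar_full.
case: v => [|a v] /=; first by rewrite expr1; ring.
by rewrite last_rcons belast_rcons !size_rcons /= !exprS; ring.
Qed.

(* The faces of [v|1] merging 1 into v and dropping it cancel. *)
Lemma bar_full_rcons1 phi v :
  bar_full phi (rcons v one) = bdiff (fun u => phi (rcons u one)) v.
Proof.
rewrite bar_full_rcons; case/lastP: v => [|v x].
  by rewrite /= expr0 /aug eqxx; ring.
by rewrite bdiff_rcons mul1 c1 /aug eqxx size_rcons exprS; ring.
Qed.

Lemma bar_full_lin r phi psi w :
  bar_full (fun u => r * phi u + psi u) w = r * bar_full phi w + bar_full psi w.
Proof. by case: w => [|a w]; rewrite /bar_full ?bdiff_lin; ring. Qed.

Lemma merges_size phi psi a w : (forall u, size u = size w -> phi u = psi u) ->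
  merges phi a w = merges psi a w.
Proof. by move=> h; apply: (@merges_local predT) => // u su _; apply: h. Qed.

Lemma bdiff_size phi psi w : (forall u, (size u).+1 = size w -> phi u = psi u) ->
  bdiff phi w = bdiff psi w.
Proof.
case: w => //= a w h; congr (_ * _ - _); first exact: h.
by apply: merges_size => u su; apply: h; rewrite su.
Qed.

Lemma bar_full_size phi psi w : (forall u, (size u).+1 = size w -> phi u = psi u) ->
  bar_full phi w = bar_full psi w.
Proof.
case: w => // a w h; rewrite /bar_full (bdiff_size h) h //.
by rewrite size_belast.
Qed.

(** Words not ending in 1 carry the given contraction, as their last face vanishes; words ending in
    1 receive another 1. Only nonempty words are contracted: the empty one spans the surviving
    degree 0. *)
Lemma bar_contraction : contractible (predC1 one) ->
  exists H : (seq T -> k) -> seq T -> k,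
  [/\ (forall r phi psi w, H (fun u => r * phi u + psi u) w = r * H phi w + H psi w),
      (forall phi psi w, (forall u, size u = (size w).+1 -> phi u = psi u) ->
         H phi w = H psi w) &
      (forall phi a w, bar_full (H phi) (a :: w) + H (bar_full phi) (a :: w) = phi (a :: w))].
Proof.
case=> H0 [lin loc hom].
have JL : left_ideal (predC1 one).
  by split=> [x y|]; rewrite /= ?eqxx // mul_eq1 negb_and => ->; rewrite orbT.
pose H phi w := if w is _ :: _ then
    if ends_in (predC1 one) w then H0 phi w else (-1) ^+ (size w).+1 * phi (rcons w one)
  else 0.
have HE phi v x : H phi (rcons v x) =
    if x == one then (-1) ^+ size v * phi (rcons (rcons v x) one) else H0 phi (rcons v x).
  rewrite /H ends_in_rcons /= size_rcons; case: (rcons v x) (size_rcons v x) => // a w _.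
  by case: eqP => //= _; rewrite !exprS; ring.
exists H; split=> [r phi psi w|phi psi w h|phi a w].
- case/lastP: w => [|v x]; first by rewrite /H; ring.
  rewrite !HE; case: eqP => /= xe; first by ring.
  by apply: lin; rewrite ends_in_rcons /=; apply/eqP.
- case/lastP: w h => [|v x] h //; rewrite !HE; case: eqP => /= xe.
    by rewrite h // size_rcons.
  by apply: loc => [|u su _]; [rewrite ends_in_rcons /=; apply/eqP | apply: h].
- rewrite lastI; move: (belast a w) (last a w) => v x.
  case: (eqVneq x one) => [->|xe].
    rewrite bar_full_rcons1 HE eqxx bar_full_rcons1.
    have -> : bdiff (fun u => H phi (rcons u one)) v =
        bdiff (fun u => (-1) ^+ size u * phi (rcons (rcons u one) one)) v.
      by apply: bdiff_size => u _; rewrite HE eqxx.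
    case/lastP: v => [|v x']; first by rewrite /= expr0 /aug eqxx; ring.
    have -> : bdiff (fun u => (-1) ^+ size u * phi (rcons (rcons u one) one)) (rcons v x') =
        (-1) ^+ size v * bdiff (fun u => phi (rcons (rcons u one) one)) (rcons v x').
      by rewrite -bdiffZ; apply: bdiff_size => u; rewrite size_rcons => -[->]; ring.
    rewrite (bdiff_rcons _ v x' one) mul1 c1 !size_rcons exprS.
    transitivity (((-1) ^+ size v * (-1) ^+ size v) * phi (rcons (rcons v x') one)); first by ring.
    by rewrite -exprMn mulrNN mulr1 expr1n mul1r.
  have Jx : ends_in (predC1 one) (rcons v x) by rewrite ends_in_rcons.
  have fullE psi u : ends_in (predC1 one) u -> bar_full psi u = bdiff psi u.
    case/lastP: u => // u y; rewrite ends_in_rcons /= bar_full_rcons /aug => /negbTE ->; ring.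
  rewrite fullE // HE (negbTE xe) -[RHS](hom phi _ Jx); congr (_ + _).
    apply: (bdiff_local JL Jx) => u _; case/lastP: u => // u y.
    by rewrite ends_in_rcons HE /= => /negbTE ->.
  by apply: loc => // u _; apply: fullE.
Qed.

End TwistedBar.

(** * Motzkin algebras *)

Section MotzkinBar.
Variables (k : comPzRingType) (n : nat) (delta eps : k).
Local Notation T := (MD n).

Definition weight (x y : T) : k :=
  delta ^+ comp_alpha (val x) (val y) * eps ^+ comp_beta (val x) (val y).

Lemma weightA x y z :
  weight x y * weight (mmul x y) z = weight y z * weight x (mmul y z).
Proof.
have [xK [yK zK]] := (MD_involutive x, (MD_involutive y, MD_involutive z)).
have ea := comp_alphaA xK yK zK; have eb := comp_betaA xK yK zK.
rewrite /weight /= mulrACA -!exprD ea eb.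
by rewrite [RHS]mulrACA -!exprD.
Qed.

Lemma weight1 x : weight x (mone n) = 1.
Proof. by have [a b] := mone_comps x; rewrite /weight a b !expr0 mulr1. Qed.

Local Notation full := (bar_full (@mmul n) weight (mone n)).

Lemma tauE (x : T) : tau k x = aug k (mone n) x.
Proof. by rewrite /tau /aug nprop_mone. Qed.

Lemma mulcE x y z : mulc delta eps x y z = if z == mmul x y then weight x y else 0.
Proof. by rewrite /mulc -val_eqE. Qed.

(** Peeling off the first letter shifts every merge position by one and flips its sign, as in the
    recursion of [merges]. *)
Lemma sum_merge phi (b : seq T) :
  \sum_(i <- iota 0 (size b)) \sum_(t <- bar_merge delta eps b i) t.1 * phi t.2 =
  if b is a :: w then - merges (@mmul n) weight phi a w else 0.
Proof.
elim: b phi => [|a b IH] phi; first by rewrite big_nil.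
rewrite /= big_cons -[1%N]addn0 iotaDl big_map.
have step i : \sum_(t <- bar_merge delta eps (a :: b) (1 + i)%N) t.1 * phi t.2 =
    - \sum_(t <- bar_merge delta eps b i) t.1 * phi (a :: t.2).
  rewrite /bar_merge /=; case: (drop i b) => [|y [|z r]]; rewrite ?big_nil ?oppr0 //.
  rewrite !big_map -sumrN; apply: eq_bigr => d _ /=; rewrite exprS; ring.
rewrite (eq_bigr (fun i => - (\sum_(t <- bar_merge delta eps b i) t.1 * phi (a :: t.2)))); last by move=> i _; apply: step.
rewrite sumrN (IH (fun u => phi (a :: u))) /bar_merge /=; case: b {IH step} => [|y b] /=.
  by rewrite big_nil; ring.
rewrite big_map big_enum /= (bigD1 (mmul a y)) //= big1 => [|d /negbTE dn].
  by rewrite mulcE eqxx expr1; ring.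
by rewrite mulcE dn; ring.
Qed.

Lemma sum_bar_terms phi (b : seq T) :
  \sum_(t <- bar_terms delta eps b) t.1 * phi t.2 = full phi b.
Proof.
have e : \sum_(t <- bar_first k b) t.1 * phi t.2 +
    (if b is a :: w then - merges (@mmul n) weight phi a w else 0) =
    bdiff (@mmul n) weight (mone n) phi b.
  by case: b => [|a w]; rewrite /bar_first ?big_nil ?big_seq1 ?addr0 //= tauE.
rewrite /bar_terms !big_cat big_flatten big_map sum_merge [LHS]addrA e.
case/lastP: b {e} => [|v x]; first by rewrite /bar_last big_nil addr0.
rewrite bar_full_rcons /bar_last rev_rcons big_seq1 size_rcons /= tauE.
have -> : take (size v) (rcons v x) = v by rewrite -cats1 take_size_cat.
by rewrite exprS mulN1r !mulNr mulrA.
Qed.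

Definition indic (u w : seq T) : k := if w == u then 1 else 0.

Lemma bar_coefE b b' : bar_coef delta eps b b' = full (indic b') b.
Proof.
rewrite -sum_bar_terms /bar_coef big_mkcond; apply: eq_bigr => t _.
by rewrite /indic; case: eqP; rewrite ?mulr1 ?mulr0.
Qed.

(** The matrix entries of a local linear operator are its values on indicators; this is what lets
    the contraction be transposed. *)
Lemma linear_expansion q (L : (seq T -> k) -> k) phi :
  (forall r phi psi, L (fun u => r * phi u + psi u) = r * L phi + L psi) ->
  (forall phi psi, (forall u, size u = q -> phi u = psi u) -> L phi = L psi) ->
  L phi = \sum_(b : q.-tuple T) L (indic b) * phi b.
Proof.
move=> lin loc; pose f (s : seq (q.-tuple T)) u := \sum_(b <- s) indic b u * phi b.
have L0 : L (fun=> 0) = 0.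
  have e : L (fun=> 0) = L (fun=> -1 * 0 + 0) by apply: loc => u _; rewrite mulr0 addr0.
  by rewrite e (lin (-1) (fun=> 0) (fun=> 0)) mulN1r addNr.
have Lf (s : seq (q.-tuple T)) : L (f s) = \sum_(b <- s) L (indic b) * phi b.
  elim: s => [|b s IH].
    by rewrite big_nil -L0; apply: loc => u _; rewrite /f big_nil.
  rewrite big_cons -IH mulrC -lin; apply: loc => u _; rewrite /f big_cons; ring.
rewrite -Lf; apply: loc => u su; rewrite /f.
have [b ->] : exists b : q.-tuple T, u = b by exists (Tuple (introT eqP su)).
rewrite (bigD1_seq b) ?mem_index_enum ?index_enum_uniq //= /indic eqxx mul1r.
rewrite big1 ?addr0 // => b' /negbTE; rewrite -val_eqE eq_sym /= => ->; ring.
Qed.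

Definition word_ext p (f : {ffun p.-tuple T -> k}) (w : seq T) : k :=
  if insub w is Some b then f b else 0.

Lemma word_extE p (f : {ffun p.-tuple T -> k}) (b : p.-tuple T) : word_ext f b = f b.
Proof. by rewrite /word_ext valK. Qed.

Lemma full_expansion p phi (b : p.+1.-tuple T) :
  full phi b = \sum_(b' : p.-tuple T) bar_coef delta eps b b' * phi b'.
Proof.
rewrite (@linear_expansion p (fun phi => full phi b)).
- by apply: eq_bigr => b' _; rewrite bar_coefE.
- by move=> r phi' psi; apply: bar_full_lin.
- by move=> phi' psi h; apply: bar_full_size => u; rewrite size_tuple => -[]; apply: h.
Qed.

Lemma bar_dualE p (f : {ffun p.-tuple T -> k}) (b : p.+1.-tuple T) :
  bar_dual delta eps f b = full (word_ext f) b.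
Proof.
by rewrite ffunE full_expansion; apply: eq_bigr => b' _; rewrite word_extE.
Qed.

Hypotheses (dU : exists d', delta * d' = 1) (eU : exists e', eps * e' = 1).

Lemma weight_unit x y : exists r, r * weight x y = 1.
Proof.
case: dU eU => d' dd [e' ee].
exists (d' ^+ comp_alpha (val x) (val y) * e' ^+ comp_beta (val x) (val y)).
by rewrite /weight mulrACA -!exprMn ![_ * delta]mulrC ![_ * eps]mulrC dd ee !expr1n mulr1.
Qed.

Let cornerT := {s : 'I_n * 'I_n | corner s}.
Let P (s : cornerT) : pred T := has_corner (val s).

Let PL s : left_ideal (@mmul n) (mone n) (P s).
Proof. by split=> [x y|]; [apply: has_corner_mmul | apply: mone_no_corner]. Qed.

(** The product creates one loop for an arc and one isolated point for an isolated row, whatever x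
    is, so a single scalar serves the whole ideal. *)
Lemma corner_weight s (h : corner s) : exists r, forall x, has_corner s x ->
  r * weight x (corner_gen h) = 1.
Proof.
have [r hr] := weight_unit (corner_gen h) (corner_gen h); exists r => x xs.
rewrite -hr /weight.
have [-> ->] := corner_comps h xs.
by have [-> ->] := corner_comps h (has_corner_gen h).
Qed.

Lemma unit_quotient (a b d e r s : k) :
  a * b = d * e -> r * a = 1 -> s * b = 1 -> d * r * s * e = 1.
Proof.
move=> abde ra sb; transitivity (r * s * (d * e)); first by ring.
rewrite -abde; transitivity ((r * a) * (s * b)); first by ring.
by rewrite ra sb mulr1.
Qed.

(** The generator is a product of corner generators. Its weights need no new component count: as x e
    = x, the cocycle identity for x, e, g expresses [weight x (mmul e g)] through known weights. *)
Lemma meet_generator (s : cornerT) (S : seq cornerT) z : meet P (s :: S) z ->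
  exists e r, [/\ meet P (s :: S) e, (forall x, meet P (s :: S) x -> mmul x e = x) &
                  (forall x, meet P (s :: S) x -> r * weight x e = 1)].
Proof.
elim: S s => [|t S IH] s.
  case: s => s h _; have [r hr] := corner_weight h; exists (corner_gen h), r; split.
  - by rewrite /meet /= /P has_corner_gen.
  - by move=> x /andP [xs _]; apply: mmul_corner.
  - by move=> x /andP [xs _]; apply: hr.
move=> /andP [zs zS]; have [e [r [eS eid er]]] := IH t zS.
case: s zs => s h zs; have [r' hr'] := corner_weight h.
have [r'' hr''] := weight_unit e (corner_gen h).
pose g := corner_gen h.
exists (mmul e g), (weight e g * r * r'); split.
- apply/andP; split; first by apply: has_corner_mmul; apply: has_corner_gen.
  rewrite -/(all _ (t :: S)); apply/(@allP _ _ (t :: S)) => t' t'S; 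
  have sub a : meet P (t :: S) a -> P t' a by move/(@allP _ _ (t :: S)); apply.
  have et' := sub _ eS; have zt' := sub _ zS.
  case: (eqVneq (val t') s) => [e'|/eqP ne].
    by rewrite /P e'; apply: has_corner_mmul; apply: has_corner_gen.
  exact: (has_corner_disjoint h (valP t') ne zt' zs et').
- by move=> x /andP [xs xS]; rewrite mmulA eid // mmul_corner.
- move=> x /andP [xs xS]; have := weightA x e g; rewrite (eid x xS) => ex.
  exact: unit_quotient ex (er x xS) (hr' x xs).
Qed.

Lemma augmentation_contractible : contractible (@mmul n) weight (mone n) (predC1 (mone n)).
Proof.
have mc (s : cornerT) S : contractible (@mmul n) weight (mone n) (meet P (s :: S)).
  case: (pickP (meet P (s :: S))) => [z zS|h]; last exact: contractible0.
  have [e [r [eS eid er]]] := meet_generator zS.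
  apply: (contractible_principal _ eS) => [|x xS]; last by split; [apply: eid | apply: er].
  split=> [x y|]; last by rewrite /meet /= /P (negbTE (mone_no_corner _)).
  by move=> /allP h; apply/allP => t tS; apply: has_corner_mmul; apply: h.
have C := contractible_cover (@mmulA n) weightA weight1 (@mmul_eq1 n) PL mc
  (L := [seq [:: s] | s <- enum {: cornerT}]).
apply: eq_contractible (C _) => [x|]; last by rewrite all_map; apply/allP.
rewrite has_map; apply/hasP/idP => [[s _]|/eqP /corner_cover [s h xs]].
  rewrite /= /meet /= andbT /P; apply: contraTneq => ->; exact: mone_no_corner.
by exists (exist _ s h); rewrite ?mem_enum //= /meet /= /P xs.
Qed.

(** * Vanishing in positive degrees *)

Lemma bar_acyclic p (x : chain k n p.+1) :
  bar_d delta eps x = 0 -> exists y : chain k n p.+2, bar_d delta eps y = x.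
Proof.
have [H [lin loc hom]] := bar_contraction (@mmul1 n) weight1 (@mmul_eq1 n) augmentation_contractible.
(* The witness is x times the matrix of H, that is, the transposed homotopy applied to x. *)
move=> dx; exists [ffun b' : p.+2.-tuple T => \sum_(b : p.+1.-tuple T) x b * H (indic b') b].
(* A cycle pairs to zero with every coboundary. *)
have dxE phi : \sum_(b : p.+1.-tuple T) x b * full phi b = 0.
  under eq_bigr do rewrite full_expansion mulr_sumr.
  rewrite exchange_big /= big1 // => b' _.
  under eq_bigr do rewrite mulrA.
  have := congr1 (fun z : chain k n p => z b') dx; rewrite !ffunE => e.
  by rewrite -mulr_suml e mul0r.
have homE phi (b : p.+1.-tuple T) : full (H phi) b + H (full phi) b = phi b.
  by case/tupleP: b => a w; apply: hom.
apply/ffunP => b''; rewrite ffunE.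
transitivity (\sum_(b : p.+1.-tuple T) x b * H (full (indic b'')) b).
  under eq_bigr do rewrite ffunE mulr_suml.
  rewrite exchange_big /=; apply: eq_bigr => b _.
  rewrite (@linear_expansion p.+2 (fun phi => H phi b)) => [|r phi psi|phi psi h].
  - by rewrite mulr_sumr; apply: eq_bigr => b' _; rewrite bar_coefE mulrA.
  - exact: lin.
  - by apply: loc => u; rewrite size_tuple; apply: h.
transitivity (\sum_(b : p.+1.-tuple T) (x b * indic b'' b - x b * full (H (indic b'')) b)).
  by apply: eq_bigr => b _; rewrite -mulrBr -(homE (indic b'') b) addrC addKr.
rewrite sumrB dxE subr0 (bigD1 b'') //= /indic eqxx mulr1 big1 ?addr0 // => b.
by rewrite -val_eqE /= => /negbTE ->; rewrite mulr0.
Qed.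

Lemma bar_dual_acyclic p (f : chain k n p.+1) :
  bar_dual delta eps f = 0 -> exists g : chain k n p, bar_dual delta eps g = f.
Proof.
have [H [lin loc hom]] := bar_contraction (@mmul1 n) weight1 (@mmul_eq1 n) augmentation_contractible.
move=> df; exists [ffun b : p.-tuple T => H (word_ext f) b]; apply/ffunP => b.
have homE phi : full (H phi) b + H (full phi) b = phi b.
  by case/tupleP: b => a w; apply: hom.
rewrite bar_dualE -(word_extE f) -(homE (word_ext f)).
(* The cocycle condition controls this function in length p + 2, which is the length that H reads at
   b. *)
have -> : H (full (word_ext f)) b = 0.
  have h0 : H (fun=> 0) b = 0.
    have e : H (fun=> 0) b = H (fun=> -1 * 0 + 0) b by apply: loc => u _; rewrite mulr0 addr0.
    by rewrite e (lin (-1) (fun=> 0) (fun=> 0)) mulN1r addNr.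
  rewrite -h0; apply: loc => u; rewrite size_tuple => su.
  have := congr1 (fun z : chain k n p.+2 => z (Tuple (introT eqP su))) df.
  by rewrite bar_dualE ffunE.
rewrite addr0; apply: bar_full_size => u; rewrite size_tuple => -[su].
by rewrite -[u]/(tval (Tuple (introT eqP su))) word_extE ffunE.
Qed.

(** The first and last faces of a one-letter word cancel; the same holds for [bar_d0]. *)
Lemma bar_dual0 (f : chain k n 0) : bar_dual delta eps f = 0.
Proof.
apply/ffunP => b; rewrite bar_dualE ffunE; case/tupleP: b => a w; rewrite tuple0 /=.
by rewrite expr1 /=; ring.
Qed.

Lemma bar_d0 (x : chain k n 1) : bar_d delta eps x = 0.
Proof.
apply/ffunP => b; rewrite !ffunE big1 // => b' _.
rewrite bar_coefE; case/tupleP: b' => a w; rewrite tuple0 /=.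
by rewrite expr1 /=; ring.
Qed.

End MotzkinBar.

Theorem theorem7p7 (k : comPzRingType) (n : nat) (delta eps : k) :
  (0 < n)%N ->
  (exists d', delta * d' = 1) ->
  (exists e', eps * e' = 1) ->
  (* Tor_0 = H_0 of the bar complex is isomorphic to k *)
  (exists phi : chain k n 0 -> k,
      (forall (a : k) (x y : chain k n 0), phi [ffun b => a * x b + y b] = a * phi x + phi y) /\
      (forall c : k, exists x, phi x = c) /\
      (forall x, phi x = 0 <-> exists y : chain k n 1, bar_d delta eps y = x)) /\
  (* Tor_p = 0 for p > 0 *)
  (forall (p : nat) (x : chain k n p.+1),
      bar_d delta eps x = 0 -> exists y : chain k n p.+2, bar_d delta eps y = x) /\
  (* Ext^0 is isomorphic to k *)
  (exists psi : k -> chain k n 0,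
      (forall a c c' : k, psi (a * c + c') = [ffun b => a * psi c b + psi c' b]) /\
      injective psi /\
      (forall f : chain k n 0, bar_dual delta eps f = 0 <-> exists c, psi c = f)) /\
  (* Ext^p = 0 for p > 0 *)
  (forall (p : nat) (f : chain k n p.+1),
      bar_dual delta eps f = 0 -> exists g : chain k n p, bar_dual delta eps g = f).
Proof.
move=> _ dU eU; split; [|split; [|split]].
(* The empty tuple is the only basis element in degree 0 and the differential next to it is zero, so
   its coefficient is the isomorphism. *)
- exists (fun x => x [tuple]); split; [|split].
  + by move=> a x y; rewrite ffunE.
  + by move=> c; exists [ffun=> c]; rewrite ffunE.
  + move=> x; split=> [x0|[y <-]]; last by rewrite bar_d0 ffunE.
    by exists 0; rewrite bar_d0; apply/ffunP => b; rewrite ffunE tuple0 x0.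
- exact: bar_acyclic.
- exists (fun c => [ffun=> c]); split; [|split].
  + by move=> a c c'; apply/ffunP => b; rewrite !ffunE.
  + by move=> c c' /ffunP/(_ [tuple]); rewrite !ffunE.
  + move=> f; split=> [_|_]; last exact: bar_dual0.
    by exists (f [tuple]); apply/ffunP => b; rewrite ffunE [b]tuple0.
- exact: bar_dual_acyclic.
Qed.
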